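(* Let $K\subset{\mathbb C^n}^*$ be a nonempty finite set. Then any finite-dimensional space $V\subset\hat{\mathcal S}(K)$ such that $V\supset\hat{\mathcal S}_0(K)$ is regular. In particular, for any integer $N\ge0$, the space of quasi-polynomials $\hat{\mathcal S}_N(K)$ is regular.
   Context: ${\mathbb C^n}^*$ is the space of complex linear functionals on $\mathbb C^n$. An analytic functional $\mu$ in ${\mathbb C^n}^*$ is a (continuous) linear functional on the space of entire functions on ${\mathbb C^n}^*$. A compact set $K\subset{\mathbb C^n}^*$ is called a support of $\mu$ if for every open neighborhood $U$ of $K$ there is a constant $C_U$ with $|\mu(f)|\le C_U\sup_U|f|$ for all entire $f$. The Borel-Fourier transform of $\mu$ is the entire function $\hat\mu(z)=\mu(\xi\mapsto e^{\xi(z)})$ on $\mathbb C^n$. $\hat{\mathcal S}(K)$ is the space of Borel-Fourier transforms of all analytic functionals having $K$ as a support. The support function of $K$ is $h_K(z)=\max_{\xi\in K}\mathrm{Re}\,\xi(z)$, $z\in\mathbb C^n$. For finite $K$ and $N\ge 0$, $\hat{\mathcal S}_N(K)$ is the space of quasi-polynomials $\sum_{\xi\in K}p_\xi(z)e^{\xi(z)}$, where each $p_\xi$ is a polynomial in $z_1,\ldots,z_n$ of degree at most $N$ (these belong to $\hat{\mathcal S}(K)$). In particular, $\hat{\mathcal S}_0(K)$ is the space of exponential sums $\sum_{\xi\in K}c_\xi e^{\xi(z)}$, $c_\xi\in\mathbb C$. Regularity: let $V\subset\hat{\mathcal S}(K)$ be a finite-dimensional subspace, fix a Hermitian inner product in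 $V$, and let $B\subset V$ be the unit ball centered at $0$. $V$ is called regular if, as $t\to+\infty$, the functions $z\mapsto\frac1t\log\max_{f\in B}|f(tz)|$ converge to $h_K$ locally uniformly on $\mathbb C^n$ (this does not depend on the inner product). *)

(* Defs.v *)
From HB Require Import structures.
From mathcomp Require Import all_boot all_order all_algebra.
From mathcomp Require Import all_classical all_reals all_analysis.
From mathcomp Require Import complex.
(* mpoly notations clash with those of the analysis library. *)
From mathcomp Require Import -(notations) mpoly.
Set Implicit Arguments.
Unset Strict Implicit.
Unset Printing Implicit Defensive.
Import Order.TTheory GRing.Theory Num.Theory.
Import numFieldNormedType.Exports.
Local Open Scope ring_scope.
Local Open Scope complex_scope.
Local Open Scope classical_set_scope.

(* The library puts the norm topology on an abstract numClosedFieldType but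
   not on the concrete type R[i]; it is transferred here from R[i]^o. *)
#[non_forgetful_inheritance]
HB.instance Definition _ (R : rcfType) := NormedModule.copy R[i] R[i]^o.

(* `|z| is an element of R[i]; this is the modulus as an element of R. *)
Definition cmod (R : realType) (z : R[i]) : R := complex.Re `|z|.

Definition cexp (R : realType) (z : R[i]) : R[i] :=
  (expR (complex.Re z))%:C *
  (cos (complex.Im z) +i* sin (complex.Im z)).

(* C^n is 'cV[R[i]]_n; its dual is the space 'rV[R[i]]_n of row vectors, acting
   by the matrix product. *)
Definition pairing (R : realType) (n : nat)
    (xi : 'rV[R[i]]_n) (z : 'cV[R[i]]_n) : R[i] :=
  (xi *m z) ord0 ord0.

(* Differentiability is over the field R[i], i.e. complex (Frechet)
   differentiability. *)
Definition entire (R : realType) (n : nat) (f : 'rV[R[i]]_n -> R[i]) : Prop :=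
  forall xi, differentiable f xi.

(* mu is a total map on functions, of which only the restriction to entire
   functions matters: that restriction is linear, and continuous for the
   topology of uniform convergence on compact sets. *)
Definition analytic_functional (R : realType) (n : nat)
    (mu : ('rV[R[i]]_n -> R[i]) -> R[i]) : Prop :=
  (forall (a : R[i]) (f g : 'rV[R[i]]_n -> R[i]), entire f -> entire g ->
     mu (a *: f + g) = a * mu f + mu g) /\
  {within ([set f | entire f] : set {family compact, 'rV[R[i]]_n -> R[i]}),
    continuous mu}.

(* The supremum may be +oo, hence the extended reals. *)
Definition is_support (R : realType) (n : nat)
    (K : set 'rV[R[i]]_n) (mu : ('rV[R[i]]_n -> R[i]) -> R[i]) : Prop :=
  compact K /\
  forall U : set 'rV[R[i]]_n, open U -> K `<=` U ->
    exists2 C : R, 0 <= C & forall f, entire f ->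
      ((cmod (mu f))%:E <= C%:E * ereal_sup [set (cmod (f xi))%:E | xi in U])%E.

Definition borel_fourier (R : realType) (n : nat)
    (mu : ('rV[R[i]]_n -> R[i]) -> R[i]) : 'cV[R[i]]_n -> R[i] :=
  fun z => mu (fun xi => cexp (pairing xi z)).

Definition Shat (R : realType) (n : nat) (K : set 'rV[R[i]]_n) :
    set ('cV[R[i]]_n -> R[i]) :=
  [set f | exists mu, [/\ analytic_functional mu, is_support K mu &
                          f = borel_fourier mu]].

(* For finite K. The degree of a polynomial p is (msize p).-1, and msize 0 = 0. *)
Definition ShatN (R : realType) (n : nat) (N : nat) (K : set 'rV[R[i]]_n) :
    set ('cV[R[i]]_n -> R[i]) :=
  [set f | exists p : 'rV[R[i]]_n -> mpoly n R[i],
     (forall xi, K xi -> (msize (p xi) <= N.+1)%N) /\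
     f = (fun z : 'cV[R[i]]_n => \sum_(xi \in K)
            meval (fun i : 'I_n => z i ord0) (p xi) * cexp (pairing xi z))].

(* For nonempty compact K the supremum is finite and attained. *)
Definition support_function (R : realType) (n : nat)
    (K : set 'rV[R[i]]_n) (z : 'cV[R[i]]_n) : R :=
  sup [set complex.Re (pairing xi z) | xi in K].

Definition linear_subspace (R : realType) (n : nat)
    (V : set ('cV[R[i]]_n -> R[i])) : Prop :=
  V 0 /\ forall (a : R[i]) (f g : 'cV[R[i]]_n -> R[i]),
           V f -> V g -> V (a *: f + g).

Definition finite_dimensional (R : realType) (n : nat)
    (V : set ('cV[R[i]]_n -> R[i])) : Prop :=
  exists (m : nat) (b : 'I_m -> 'cV[R[i]]_n -> R[i]),
    (forall i, V (b i)) /\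
    forall f, V f -> exists c : 'I_m -> R[i], f = \sum_(i < m) c i *: b i.

(* Only the values of ip on V matter. In R[i], 0 < x means that x is real and
   positive. *)
Definition hermitian_inner_product (R : realType) (n : nat)
    (V : set ('cV[R[i]]_n -> R[i]))
    (ip : ('cV[R[i]]_n -> R[i]) -> ('cV[R[i]]_n -> R[i]) -> R[i]) : Prop :=
  [/\ forall (a : R[i]) f g h, V f -> V g -> V h ->
        ip (a *: f + g) h = a * ip f h + ip g h,
      forall f g, V f -> V g -> ip g f = Num.conj (ip f g) &
      forall f, V f -> f <> 0 -> 0 < ip f f].

Definition unit_ball (R : realType) (n : nat)
    (V : set ('cV[R[i]]_n -> R[i]))
    (ip : ('cV[R[i]]_n -> R[i]) -> ('cV[R[i]]_n -> R[i]) -> R[i]) :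
    set ('cV[R[i]]_n -> R[i]) :=
  [set f | V f /\ ip f f <= 1].

(* (1/t) log max_(f in B) |f(t z)|, equal to -oo where every f in B vanishes. *)
Definition log_growth (R : realType) (n : nat)
    (B : set ('cV[R[i]]_n -> R[i])) (t : R) (z : 'cV[R[i]]_n) : \bar R :=
  ((t^-1)%:E * lne (ereal_sup [set (cmod (f (t%:C *: z)))%:E | f in B]))%E.

Definition locally_uniform_cvg (R : realType) (n : nat)
    (F : R -> 'cV[R[i]]_n -> \bar R) (h : 'cV[R[i]]_n -> R) : Prop :=
  forall z0 : 'cV[R[i]]_n, exists2 U : set 'cV[R[i]]_n, nbhs z0 U &
    forall e : R, 0 < e ->
      \forall t \near +oo, forall z, U z -> (`| F t z - (h z)%:E | < e%:E)%E.

(* The limit does not depend on the inner product, so the definition quantifies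
   over all of them. *)
Definition regular (R : realType) (n : nat)
    (K : set 'rV[R[i]]_n) (V : set ('cV[R[i]]_n -> R[i])) : Prop :=
  [/\ linear_subspace V, finite_dimensional V, V `<=` Shat K &
      forall ip, hermitian_inner_product V ip ->
        locally_uniform_cvg (log_growth (unit_ball V ip)) (support_function K)].

(* Main.v *)
Require Import Defs.
From mathcomp Require Import all_boot all_order all_algebra.
From mathcomp Require Import all_classical all_reals all_analysis.
From mathcomp Require Import complex.
From mathcomp Require Import -(notations) finmap mpoly.
From mathcomp Require Import ring lra.
Set Implicit Arguments.
Unset Strict Implicit.
Unset Printing Implicit Defensive.
Import Order.TTheory GRing.Theory Num.Theory.
Import numFieldNormedType.Exports.

Local Open Scope ring_scope.
Local Open Scope complex_scope.
Local Open Scope classical_set_scope.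

(** Write [h] for the support function of [K] and [B] for the unit ball of [V].

    Upper estimate. Let [f] be the transform of a functional supported by [K].
    Its bound over the [e]-neighborhood of [K], applied to the exponentials
    [xi |-> exp (xi z)], gives [|f z| <= C exp (h z + e |z|)] ([Shat_growth]).
    The elements of [B] are dominated pointwise by the sum of the moduli of
    finitely many elements of [V] ([unit_ball_dominated]), so one constant [C]
    serves for all of [B].

    Lower estimate. Since [K] is finite and [V] contains the exponentials
    [exp (xi z)] with [xi] in [K], some multiple [d exp (xi z)] lies in [B] for
    all [xi] at once. At the point [t z], for [xi] maximizing [Re (xi z)], it has
    modulus [d exp (t h z)]. Taking logarithms and dividing by [t], the constants
    [d] and [C] disappear in the limit, uniformly for bounded [z]
    ([log_growth_cvg]).

    Quasi-polynomials. It remains to see that [p(z) exp (xi z)] is the transform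
    of a functional supported at [xi], namely of [p] in the partial derivatives,
    evaluated at [xi]. The difficulty is to bound derivatives at [xi] by suprema
    over arbitrarily small neighborhoods for functions that are only assumed
    complex differentiable at every point, and it reduces to one variable.
    For a direction [l], the [k]-th Taylor coefficient at [0] of
    [y |-> f (xi + y l)], defined by Cauchy's integral, is a functional whose
    transform is [(l z)^k exp (xi z) / k!]. The integral does not depend on the
    radius of the circle; in the logarithmic coordinate this is Goursat's theorem
    for a rectangle whose horizontal sides cancel ([cmean_vertical_shift]), and
    Goursat's bisection is carried out for pairs of real functions in
    [green_rectangle]. Hence the circle may be shrunk, and the functional is
    supported at [xi]. Finally every monomial is a linear combination of powers of
    linear forms: the coefficients of a vector-valued polynomial lie in the span of
    its values ([coefficient_in_subspace]), and this is applied to the powers of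
    [l + s a] as polynomials in [s] ([linear_form_supported]). *)

(** * Modulus and exponential of complex numbers *)

Section ComplexModulus.
Variable R : realType.
Implicit Types z w : R[i].

Lemma cmodE z : `|z| = (cmod z)%:C.
Proof. by rewrite /cmod normc_def. Qed.

Lemma cmod_ge0 z : 0 <= cmod z.
Proof. by rewrite /cmod normc_def sqrtr_ge0. Qed.

Lemma cmodM z w : cmod (z * w) = cmod z * cmod w.
Proof.
by apply/eqP; rewrite -(inj_eq (@complexI R)) rmorphM /= -!cmodE normrM.
Qed.

Lemma cmodD z w : cmod (z + w) <= cmod z + cmod w.
Proof. by rewrite -lecR rmorphD /= -!cmodE ler_normD. Qed.

Lemma cmodN z : cmod (- z) = cmod z.
Proof. by rewrite /cmod normrN. Qed.

Lemma cmodB z w : cmod (z - w) = cmod (w - z).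
Proof. by rewrite -cmodN opprB. Qed.

Lemma cmod0 : cmod (0 : R[i]) = 0.
Proof. by rewrite /cmod normr0. Qed.

Lemma cmod_eq0 z : (cmod z == 0) = (z == 0).
Proof. by rewrite -(inj_eq (@complexI R)) /= -cmodE normr_eq0. Qed.

Lemma cmodR (x : R) : cmod x%:C = `|x|.
Proof. by rewrite /cmod normc_def /= expr0n addr0 sqrtr_sqr. Qed.

Lemma cmodi : cmod ('i%C : R[i]) = 1.
Proof. by rewrite /cmod normc_def /= expr0n add0r expr1n sqrtr1. Qed.

Lemma cmod_sum (I : Type) (s : seq I) (P : pred I) (F : I -> R[i]) :
  cmod (\sum_(i <- s | P i) F i) <= \sum_(i <- s | P i) cmod (F i).
Proof.
elim/big_rec2 : _ => [|i y x _ h]; first by rewrite cmod0.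
exact: le_trans (cmodD _ _) (lerD (lexx _) h).
Qed.

Lemma cmod_Re z : `|complex.Re z| <= cmod z.
Proof.
rewrite /cmod normc_def /= -sqrtr_sqr ler_wsqrtr //.
by rewrite lerDl sqr_ge0.
Qed.

Lemma cmod_Im z : `|complex.Im z| <= cmod z.
Proof.
rewrite /cmod normc_def /= -sqrtr_sqr ler_wsqrtr //.
by rewrite lerDr sqr_ge0.
Qed.

Lemma cmod_ReIm z : cmod z <= `|complex.Re z| + `|complex.Im z|.
Proof.
rewrite {1}(complexE z); apply: le_trans (cmodD _ _) _.
by rewrite cmodM cmodi mul1r !cmodR.
Qed.

Lemma gt0_complexR (e : R[i]) : 0 < e -> e = (complex.Re e)%:C /\ 0 < complex.Re e.
Proof. by case: e => a b; rewrite ltcE /= => /andP[/eqP -> ->]. Qed.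

Lemma cexpD z w : cexp (z + w) = cexp z * cexp w.
Proof.
case: z w => [a b] [c d]; rewrite /cexp /= expRD cosD sinD.
by simpc; apply/eqP; rewrite eq_complex /=; apply/andP; split; apply/eqP; ring.
Qed.

Lemma cexp0 : cexp (0 : R[i]) = 1.
Proof. by rewrite /cexp /= expR0 cos0 sin0 mul1r. Qed.

Lemma cmod_cexp z : cmod (cexp z) = expR (complex.Re z).
Proof.
rewrite /cexp cmodM cmodR ger0_norm ?expR_ge0 //.
by rewrite /cmod normc_def /= cos2Dsin2 sqrtr1 mulr1.
Qed.

End ComplexModulus.

(** * Complex derivatives *)

Section Derivative.
Variable K : numFieldType.

Lemma nbhs0_le (P : K -> Prop) :
  (\forall h \near (0 : K), P h) <->
  exists2 d : K, 0 < d & forall h, `|h| <= d -> P h.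
Proof.
split.
- move=> /nbhs_normP[e /= e0 h]; exists (e / 2); first by rewrite divr_gt0.
  move=> z zd; apply: h; rewrite /= sub0r normrN.
  by apply: le_lt_trans zd _; rewrite ltr_pdivrMr // ltr_pMr // ltr1n.
- move=> [d d0 h]; apply/nbhs_normP; exists d => //.
  by move=> z /=; rewrite sub0r normrN => /ltW; exact: h.
Qed.

(** Differentiability unfolded into a first order expansion with an explicit
    radius, for real and for complex scalars at once. *)
Lemma is_derive_expansion (G : K -> K) (w D : K) :
  is_derive w (1 : K) G D <->
  forall e : K, 0 < e -> exists2 d : K, 0 < d &
    forall h, `|h| <= d -> `|G (w + h) - G w - h * D| <= e * `|h|.
Proof.
split.
- move=> [] /derivable1_diffP hG DE e e0.
  have dG := proj1 (eqaddoP _ _ _ _) (diff_locally hG).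
  have /nbhs0_le[d d0 h] := dG _ e0.
  exists d => // z /h /=; rewrite [w + z]addrC.
  set X := (X in `|X|); set Y := (X in _ -> `|X| <= _).
  suff -> : X = Y by [].
  rewrite /X /Y /= opprD addrA; congr (_ - _).
  rewrite -{1}[z]mulr1 -[z * 1]/(z *: (1 : K)) linearZ /=.
  by rewrite -deriveE // DE.
- move=> dG.
  suff cG : h^-1 *: ((G \o shift w) (h *: (1 : K)) - G w) @[h --> 0^'] --> D.
    split; first by apply/cvg_ex; exists D.
    exact: cvg_lim cG.
  apply/cvgrPdist_le => e e0; have [d d0 h] := dG _ e0.
  rewrite near_withinE; apply/nbhs0_le; exists d => // z zd z0.
  rewrite /= -[z *: 1]/(z * 1) mulr1 -[_ *: _]/(z^-1 * _).
  have z0' : 0 < `|z| by rewrite normr_gt0.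
  rewrite -(ler_pM2r z0') distrC -normrM.
  suff -> : (z^-1 * (G (z + w) - G w) - D) * z = G (w + z) - G w - z * D.
    exact: h.
  by rewrite [w + z]addrC; field.
Qed.

End Derivative.

Section ComplexDerivative.
Variable R : realType.
Implicit Types (z w D : R[i]) (G : R[i] -> R[i]).

(** Norms in [R[i]] are elements of [R[i]]; here the error and the radius are
    real numbers, so that they can be compared and combined freely. *)
Lemma is_derive_cmod G w D :
  is_derive w (1 : R[i]) G D <->
  forall e : R, 0 < e -> exists2 d : R, 0 < d &
    forall h, cmod h <= d -> cmod (G (w + h) - G w - h * D) <= e * cmod h.
Proof.
split=> [/is_derive_expansion dG e e0|dG].
- have /dG[d /gt0_complexR[-> d0] h] : 0 < e%:C by rewrite ltcR.
  exists (complex.Re d) => // z zd.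
  by rewrite -lecR rmorphM /= -!cmodE; apply: h; rewrite cmodE lecR.
- apply/is_derive_expansion => e /gt0_complexR[-> e0].
  have [d d0 h] := dG _ e0; exists d%:C; first by rewrite ltcR.
  by move=> z; rewrite !cmodE -rmorphM /= !lecR; exact: h.
Qed.

Lemma is_derive_Re_line G (a b : R[i]) (t : R) D :
  is_derive (a + t%:C * b) (1 : R[i]) G D ->
  is_derive t (1 : R) (fun s : R => complex.Re (G (a + s%:C * b)))
    (complex.Re (b * D)).
Proof.
move=> /is_derive_cmod dG; apply/is_derive_expansion => e e0.
have b0 : 0 < cmod b + 1 by rewrite ltr_wpDl ?cmod_ge0.
have [d d0 h] := dG _ (divr_gt0 e0 b0).
exists (d / (cmod b + 1)); first exact: divr_gt0.
move=> s sd; have hb : cmod (s%:C * b) <= `|s| * (cmod b + 1).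
  by rewrite cmodM cmodR ler_wpM2l // lerDl.
have /h : cmod (s%:C * b) <= d.
  by apply: le_trans hb _; rewrite -ler_pdivlMr.
have <- : a + (t + s)%:C * b = a + t%:C * b + s%:C * b.
  by rewrite rmorphD /= mulrDl addrA.
rewrite -mulrA => hs.
have -> : complex.Re (G (a + (t + s)%:C * b)) - complex.Re (G (a + t%:C * b)) -
    s * complex.Re (b * D) =
  complex.Re (G (a + (t + s)%:C * b) - G (a + t%:C * b) - s%:C * (b * D)).
  by rewrite !raddfB /=; case: (b * D) => u v /=; rewrite mul0r subr0.
apply: le_trans (cmod_Re _) _; apply: le_trans hs _.
apply: le_trans (ler_wpM2l (ltW (divr_gt0 e0 b0)) hb) _.
by rewrite mulrCA divfK ?gt_eqF // mulrC.
Qed.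

(** By the functional equation only the expansion at [0] is needed, and there
    [cexp (x + i y) - 1 - x - i y] is controlled by the expansions of the real
    functions [expR x], [cos y] and [sin y]. *)
Lemma is_derive_cexp w : is_derive w (1 : R[i]) (@cexp R) (cexp w).
Proof.
apply/is_derive_cmod => e e0.
have w0 : 0 < cmod (cexp w) by rewrite cmod_cexp expR_gt0.
(* The real part contributes 3 * k * |h| to the error, the imaginary part 5 * k * |h|. *)
pose k := Num.min 1 (e / cmod (cexp w) / 8).
have k0 : 0 < k by rewrite lt_min ltr01 !divr_gt0.
have [k1 k8] : k <= 1 /\ 8 * k * cmod (cexp w) <= e.
  split; first by rewrite ge_min lexx.
  have : k <= e / cmod (cexp w) / 8 by rewrite ge_min lexx orbT.
  by rewrite !ler_pdivlMr // (mulrC k).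
move: k k0 k1 k8 => k k0 k1 k8.
have [d1 d10 h1] := proj1 (is_derive_expansion _ _ _) (is_derive_expR (0 : R)) _ k0.
have [d2 d20 h2] := proj1 (is_derive_expansion _ _ _) (is_derive_cos (0 : R)) _ k0.
have [d3 d30 h3] := proj1 (is_derive_expansion _ _ _) (is_derive_sin (0 : R)) _ k0.
exists (Num.min k (Num.min d1 (Num.min d2 d3))); first by rewrite !lt_min; apply/and4P; split.
move=> h; rewrite !le_min => /and4P[hk hd1 hd2 hd3].
have -> : cexp (w + h) - cexp w - h * cexp w = cexp w * (cexp h - 1 - h).
  by rewrite cexpD; ring.
rewrite cmodM.
suff H : cmod (cexp h - 1 - h) <= 8 * k * cmod h.
  apply: le_trans (ler_wpM2l (ltW w0) H) _.
  by rewrite mulrA ler_wpM2r ?cmod_ge0 // mulrC.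
have hx := cmod_Re h; have hy := cmod_Im h.
apply: le_trans (cmod_ReIm _) _.
move: hx hy hk hd1 hd2 hd3; move: (cmod h) => r; case: h => x y /= hx hy hk hd1 hd2 hd3.
have := h1 _ (le_trans hx hd1); have := h2 _ (le_trans hy hd2).
have := h3 _ (le_trans hy hd3).
rewrite !add0r expR0 cos0 sin0 !oppr0 !mulr1 !mulr0 !mul0r !oppr0 !addr0.
have C1 := cos_le1 y; have C2 := cos_geN1 y.
have r0 : 0 <= r := le_trans (normr_ge0 x) hx.
set X := expR x; set C := cos y in C1 C2 *; set S := sin y => a1 a2 a3.
have kx := ler_wpM2l (ltW k0) hx; have ky := ler_wpM2l (ltW k0) hy.
have kr1 : k * r <= r by rewrite ler_piMl.
have rk : r * r <= k * r by rewrite ler_wpM2r.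
have b1 : `|X * C - 1 - x| <= 3 * (k * r).
  have -> : X * C - 1 - x = (X - 1 - x) * C + (1 + x) * (C - 1) by ring.
  have c1 : `|(X - 1 - x) * C| <= k * r * 1.
    by rewrite normrM ler_pM // ?(le_trans a3) // ler_norml C2 C1.
  have c2 : `|(1 + x) * (C - 1)| <= 2 * (k * r).
    rewrite normrM ler_pM // ?(le_trans a2) //.
    by apply: le_trans (ler_normD _ _) _; rewrite normr1; lra.
  by apply: le_trans (ler_normD _ _) _; lra.
have b2 : `|X * S - y| <= 5 * (k * r).
  have -> : X * S - y = (X - 1) * S + (S - y) by ring.
  have c1 : `|(X - 1) * S| <= 2 * r * (2 * r).
    rewrite normrM ler_pM //.
      have -> : X - 1 = (X - 1 - x) + x by ring.
      by apply: le_trans (ler_normD _ _) _; lra.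
    have -> : S = (S - y) + y by ring.
    by apply: le_trans (ler_normD _ _) _; lra.
  by apply: le_trans (ler_normD _ _) _; lra.
lra.
Qed.

End ComplexDerivative.
(** * Integrals over segments and Green's formula on rectangles *)

Section SegmentIntegral.
Variable R : realType.
Implicit Types (f g : R -> R) (a b m k : R).

Definition rint f a b : R := \int[@lebesgue_measure R]_(x in `[a, b]) f x.

Lemma continuous_integrable f a b : continuous f ->
  (@lebesgue_measure R).-integrable `[a, b] (EFin \o f).
Proof.
move=> cf; apply: continuous_compact_integrable; first exact: segment_compact.
exact: continuous_subspaceT.
Qed.

Lemma rintD f g a b : continuous f -> continuous g ->
  rint (fun x => f x + g x) a b = rint f a b + rint g a b.
Proof. by move=> cf cg; apply: RintegralD => //; exact: continuous_integrable. Qed.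

Lemma rintB f g a b : continuous f -> continuous g ->
  rint (fun x => f x - g x) a b = rint f a b - rint g a b.
Proof. by move=> cf cg; apply: RintegralB => //; exact: continuous_integrable. Qed.

Lemma rintZ f k a b : continuous f -> rint (fun x => k * f x) a b = k * rint f a b.
Proof. by move=> cf; apply: RintegralZl => //; exact: continuous_integrable. Qed.

Lemma eq_rint f g a b : (forall x, a <= x <= b -> f x = g x) -> rint f a b = rint g a b.
Proof.
by move=> fg; apply: eq_Rintegral => x /set_mem; rewrite /= in_itv /= => /fg.
Qed.

Lemma rint_cst k a b : a <= b -> rint (fun=> k) a b = k * (b - a).
Proof.
move=> ab; rewrite /rint Rintegral_cst //= lebesgue_measure_itv /= lte_fin.
case: ltP => // ba; have -> : a = b by apply/le_anti; rewrite ab.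
by rewrite subrr.
Qed.

Lemma rint_split f a m b : continuous f -> a <= m -> m <= b ->
  rint f a b = rint f a m + rint f m b.
Proof.
move=> cf am mb.
have := @Rintegral_itvB R f (BLeft a) (BRight b) m (continuous_integrable _ _ cf).
rewrite !bnd_simp => /(_ am mb).
rewrite Rintegral_itv_obnd_cbnd; last first.
  apply: (integrableS _ _ _ (continuous_integrable m b cf)) => //.
  exact: subset_itv_oc_cc.
by rewrite -/(rint f a b) -/(rint f a m) -/(rint f m b) => <-; rewrite addrC subrK.
Qed.

(** One estimate serves for bounds ([k = 0]) and for the comparison of an
    integrand with its first order approximation. *)
Lemma rint_close f k E a b : continuous f -> a <= b ->
  (forall x, a <= x <= b -> `|f x - k| <= E) ->
  `|rint f a b - k * (b - a)| <= E * (b - a).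
Proof.
move=> cf ab fkE; rewrite -(rint_cst k) // -rintB //; last exact: cst_continuous.
have cfk : continuous (fun x => f x - k).
  by move=> x; apply: cvgB; [exact: cf|exact: cvg_cst].
apply: le_trans (le_normr_Rintegral _ (continuous_integrable _ _ cfk)) _ => //.
rewrite -(rint_cst E) //; apply: le_Rintegral => //.
- by apply: continuous_integrable => x; apply: cvg_norm; exact: cfk.
- by apply: continuous_integrable; exact: cst_continuous.
Qed.

Lemma rint_derive f F a b : a < b -> continuous f ->
  (forall x, is_derive x (1 : R) F (f x)) -> rint f a b = F b - F a.
Proof.
move=> ab cf dF.
have cF : continuous F.
  by move=> x; apply/differentiable_continuous/derivable1_diffP; case: (dF x).
rewrite /rint /Rintegral (@continuous_FTC2 _ f F a b) //.
- exact: continuous_subspaceT.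
- split.
  + by move=> x _; case: (dF x).
  + by apply: cvg_at_right_filter; exact: cF.
  + by apply: cvg_at_left_filter; exact: cF.
- by move=> x _; rewrite derive1E derive_val.
Qed.

End SegmentIntegral.

Section Green.
Variable R : realType.

Lemma nested_intervals (u : nat -> R) (L : R) :
  (forall n, u n <= u n.+1 /\ u n.+1 + L / 2 ^+ n.+1 <= u n + L / 2 ^+ n) ->
  0 <= L -> exists x, forall n, u n <= x <= u n + L / 2 ^+ n.
Proof.
move=> hu L0; pose w n := L / 2 ^+ n.
have w0 n : 0 <= w n by rewrite divr_ge0 // exprn_ge0.
have um n m : u n <= u (n + m)%N.
  elim: m => [|m ih]; first by rewrite addn0.
  by rewrite addnS; apply: le_trans ih (hu _).1.
have vm n m : u (n + m)%N + w (n + m)%N <= u n + w n.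
  elim: m => [|m ih]; first by rewrite addn0.
  by rewrite addnS; apply: le_trans (hu _).2 ih.
have uv n m : u m <= u n + w n.
  apply: le_trans (um m n) _; rewrite addnC; apply: le_trans (vm n m).
  by rewrite lerDl.
have sup_u : has_sup (range u).
  by split; [exists (u 0%N), 0%N | exists (u 0%N + w 0%N) => _ [m _ <-]; exact: uv].
exists (sup (range u)) => n; apply/andP; split.
- by apply: (ub_le_sup sup_u.2); exists n.
- by apply: (ge_sup sup_u.1) => _ [m _ <-]; exact: uv.
Qed.

(** Total differentiability at a single point, which is all that Goursat's
    bisection asks for. *)
Definition total_diff (p : R -> R -> R) (p1 p2 x y : R) : Prop :=
  forall e, 0 < e -> exists2 d, 0 < d & forall x' y', `|x' - x| <= d -> `|y' - y| <= d ->
    `|p x' y' - p x y - p1 * (x' - x) - p2 * (y' - y)| <= e * (`|x' - x| + `|y' - y|).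

Variables p q : R -> R -> R.
Hypothesis p_cont : forall x, continuous (p x).
Hypothesis q_cont : forall y, continuous (q^~ y).
Hypothesis pq : forall x y, exists p1 p2 q1,
  total_diff p p1 p2 x y /\ total_diff q q1 p1 x y.

(** The integral of [p dy + q dx] over the boundary of a rectangle. *)
Let J a b c d := rint (fun y => p b y - p a y) c d - rint (fun x => q x d - q x c) a b.

Let p_cont2 a b : continuous (fun y => p b y - p a y).
Proof. by move=> y; apply: cvgB; exact: p_cont. Qed.

Let q_cont2 c d : continuous (fun x => q x d - q x c).
Proof. by move=> y; apply: cvgB; exact: q_cont. Qed.

Let J_split_x a m b c d : a <= m -> m <= b -> J a b c d = J a m c d + J m b c d.
Proof.
move=> am mb; rewrite /J (@rint_split _ _ a m b) //.
rewrite addrACA -opprD; congr (_ - _).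
rewrite -rintD; try exact: p_cont2.
by apply: eq_rint => y _; ring.
Qed.

Let J_split_y a b c m d : c <= m -> m <= d -> J a b c d = J a b c m + J a b m d.
Proof.
move=> cm md; rewrite /J (@rint_split _ _ c m d) //.
rewrite addrACA -opprD; congr (_ - _).
rewrite -rintD; try exact: q_cont2.
by apply: eq_rint => y _; ring.
Qed.

(** Near a point the two boundary integrals of a small rectangle both equal
    the common partial derivative times the area, up to an error that is small
    compared with the square of the diameter. *)
Let J_small x0 y0 (e : R) : 0 < e -> exists2 r, 0 < r &
  forall a b c d, a <= x0 <= b -> c <= y0 <= d -> b - a + (d - c) <= r ->
    `|J a b c d| <= 4 * e * (b - a + (d - c)) ^+ 2.
Proof.
move=> e0; have [p1 [p2 [q1 [hp hq]]]] := pq x0 y0.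
have [r1 r10 {}hp] := hp _ e0; have [r2 r20 {}hq] := hq _ e0.
exists (Num.min r1 r2); first by rewrite lt_min r10.
move=> a b c d /andP[ax xb] /andP[cy yd]; rewrite le_min => /andP[hr1 hr2].
set s := b - a + (d - c) in hr1 hr2 *.
have ab : a <= b := le_trans ax xb; have cd : c <= d := le_trans cy yd.
have bx x : a <= x <= b -> `|x - x0| <= b - a by move=> /andP[h1 h2]; rewrite ler_norml; lra.
have dy y : c <= y <= d -> `|y - y0| <= d - c by move=> /andP[h1 h2]; rewrite ler_norml; lra.
have close x y : a <= x <= b -> c <= y <= d ->
    `|p x y - p x0 y0 - p1 * (x - x0) - p2 * (y - y0)| <= e * s /\
    `|q x y - q x0 y0 - q1 * (x - x0) - p1 * (y - y0)| <= e * s.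
  move=> /bx hx /dy hy; split.
  - apply: le_trans (hp _ _ _ _) _; try by move: hr1 hr2; rewrite /s; clear -ab cd hx hy; lra.
    by rewrite ler_pM2l // lerD.
  - apply: le_trans (hq _ _ _ _) _; try by move: hr1 hr2; rewrite /s; clear -ab cd hx hy; lra.
    by rewrite ler_pM2l // lerD.
have aab : a <= a <= b by rewrite lexx. have bab : a <= b <= b by rewrite lexx andbT.
have ccd : c <= c <= d by rewrite lexx. have dcd : c <= d <= d by rewrite lexx andbT.
have Jp := @rint_close R (fun y => p b y - p a y) (p1 * (b - a)) (2 * (e * s)) c d
  (p_cont2 (a := a) (b := b)) cd.
have Jq := @rint_close R (fun x => q x d - q x c) (p1 * (d - c)) (2 * (e * s)) a b
  (q_cont2 (c := c) (d := d)) ab.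
have {}Jp : `|rint (fun y => p b y - p a y) c d - p1 * (b - a) * (d - c)| <=
    2 * (e * s) * (d - c).
  apply: Jp => y hy; have [h1 _] := close _ _ aab hy; have [h2 _] := close _ _ bab hy.
  have -> : p b y - p a y - p1 * (b - a) =
    (p b y - p x0 y0 - p1 * (b - x0) - p2 * (y - y0)) -
    (p a y - p x0 y0 - p1 * (a - x0) - p2 * (y - y0)) by ring.
  by apply: le_trans (ler_normB _ _) _; lra.
have {}Jq : `|rint (fun x => q x d - q x c) a b - p1 * (d - c) * (b - a)| <=
    2 * (e * s) * (b - a).
  apply: Jq => x hx; have [_ h1] := close _ _ hx ccd; have [_ h2] := close _ _ hx dcd.
  have -> : q x d - q x c - p1 * (d - c) =
    (q x d - q x0 y0 - q1 * (x - x0) - p1 * (d - y0)) -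
    (q x c - q x0 y0 - q1 * (x - x0) - p1 * (c - y0)) by ring.
  by apply: le_trans (ler_normB _ _) _; lra.
have es : 0 <= e * s * s by rewrite -mulrA mulr_ge0 ?(ltW e0) // -expr2 sqr_ge0.
have -> : J a b c d =
  (rint (fun y => p b y - p a y) c d - p1 * (b - a) * (d - c)) -
  (rint (fun x => q x d - q x c) a b - p1 * (d - c) * (b - a)) by rewrite /J; ring.
apply: le_trans (ler_normB _ _) _; apply: le_trans (lerD Jp Jq) _.
rewrite -mulrDr [d - c + _]addrC -/s.
rewrite expr2 -!mulrA in es *; lra.
Qed.

(** Goursat's bisection: if the integral over the boundary of the rectangle
    were nonzero, one of its four quarters would carry at least a quarter of
    it, and so on; this contradicts [J_small] at the common point of the
    nested rectangles. *)
Lemma green_rectangle a b c d : a <= b -> c <= d ->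
  rint (fun y => p b y - p a y) c d = rint (fun x => q x d - q x c) a b.
Proof.
move=> ab cd; apply/eqP; rewrite -subr_eq0 -/(J a b c d); apply/negPn/negP => J0.
pose L := b - a; pose M := d - c; pose eta := `|J a b c d|.
have L0 : 0 <= L by rewrite subr_ge0. have M0 : 0 <= M by rewrite subr_ge0.
have eta0 : 0 < eta by rewrite normr_gt0.
(* Rectangles of the n-th generation are given by their lower left corner. *)
pose bad n (u : R * R) :=
  eta / 4 ^+ n <= `|J u.1 (u.1 + L / 2 ^+ n) u.2 (u.2 + M / 2 ^+ n)|.
pose next n (u : R * R) := 
  let a' := u.1 + L / 2 ^+ n.+1 in let c' := u.2 + M / 2 ^+ n.+1 in
  if bad n.+1 (u.1, u.2) then (u.1, u.2) else
  if bad n.+1 (a', u.2) then (a', u.2) else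
  if bad n.+1 (u.1, c') then (u.1, c') else (a', c').
have halfS (N : R) n : N / 2 ^+ n = N / 2 ^+ n.+1 + N / 2 ^+ n.+1.
  by rewrite exprS; field; rewrite expf_neq0.
have quartS n : eta / 4 ^+ n = 4 * (eta / 4 ^+ n.+1).
  by rewrite exprS; field; rewrite expf_neq0.
have next_bad n u : bad n u -> bad n.+1 (next n u).
  case: u => x y; rewrite /next /=.
  case: ifPn => // h1; case: ifPn => // h2; case: ifPn => // h3.
  move=> hb; apply/negPn/negP => h4; move: hb; apply/negP.
  move: h1 h2 h3 h4; rewrite /bad /= -!ltNge => h1 h2 h3 h4.
  have w0 (N : R) m : 0 <= N -> 0 <= N / 2 ^+ m by move=> ?; rewrite divr_ge0 ?exprn_ge0.
  rewrite (halfS L n) (halfS M n) !addrA quartS.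
  rewrite (@J_split_x x (x + L / 2 ^+ n.+1)) ?lerDl ?w0 //.
  rewrite (@J_split_y x _ y (y + M / 2 ^+ n.+1)) ?lerDl ?w0 //.
  rewrite (@J_split_y (x + _) _ y (y + M / 2 ^+ n.+1)) ?lerDl ?w0 //.
  apply: le_lt_trans (ler_normD (_ + _) (_ + _)) _.
  apply: le_lt_trans (lerD (ler_normD _ _) (ler_normD (J _ _ _ _) _)) _.
  lra.
pose fix u n := if n is n'.+1 then next n' (u n') else (a, c).
have u_bad n : bad n (u n).
  elim: n => [|n ih]; last exact: next_bad.
  by rewrite /bad /= !expr0 !divr1 /L /M ![_ + (_ - _)]addrC !subrK.
have [|x0 hx0] := @nested_intervals (fun n => (u n).1) L _ L0.
  move=> n; rewrite /= (halfS L n) /next.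
  have w0 : 0 <= L / 2 ^+ n.+1 by rewrite divr_ge0 ?exprn_ge0.
  by do 3?[case: ifP => _ /=]; lra.
have [|y0 hy0] := @nested_intervals (fun n => (u n).2) M _ M0.
  move=> n; rewrite /= (halfS M n) /next.
  have w0 : 0 <= M / 2 ^+ n.+1 by rewrite divr_ge0 ?exprn_ge0.
  by do 3?[case: ifP => _ /=]; lra.
(* With this e the bound of J_small is less than eta / 4 ^+ n on the n-th
   rectangle; the summand 1 is there for degenerate rectangles. *)
pose e := eta / (8 * ((L + M) ^+ 2 + 1)).
have den0 : 0 < 8 * ((L + M) ^+ 2 + 1) :> R.
  by apply: mulr_gt0 => //; apply: ltr_wpDl => //; exact: sqr_ge0.
have e0 : 0 < e by rewrite divr_gt0.
have [r r0 hr] := J_small x0 y0 e0.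
have [n hn] : exists n, (L + M) / 2 ^+ n <= r.
  exists (Num.bound ((L + M) / r)).
  rewrite ler_pdivrMr ?exprn_gt0 // mulrC -ler_pdivrMr //.
  apply: le_trans (ltW (archi_boundP _)) _; first by apply: divr_ge0; [exact: addr_ge0|exact: ltW].
  by rewrite -natrX ler_nat ltnW // ltn_expl.
have := u_bad n; rewrite /bad; apply/negP; rewrite -ltNge.
have := hr (u n).1 ((u n).1 + L / 2 ^+ n) (u n).2 ((u n).2 + M / 2 ^+ n) (hx0 n) (hy0 n).
rewrite ![_ + _ / _]addrC !addrK -mulrDl => /(_ hn) h.
apply: le_lt_trans h _.
have -> : 4 * e * ((L + M) / 2 ^+ n) ^+ 2 = 4 * e * (L + M) ^+ 2 / 4 ^+ n.
  have pw : (2 ^+ n) ^+ 2 = 4 ^+ n :> R.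
    by rewrite -exprM mulnC exprM; congr (_ ^+ _); rewrite -natrX.
  by rewrite exprMn exprVn pw mulrA.
rewrite ltr_pM2r ?invr_gt0 ?exprn_gt0 //.
have -> : eta = e * (8 * ((L + M) ^+ 2 + 1)) by rewrite /e divfK // gt_eqF.
have : 0 <= e * (L + M) ^+ 2 by rewrite mulr_ge0 ?sqr_ge0 // ltW.
set X := (L + M) ^+ 2 => eX; rewrite -subr_gt0.
have -> : e * (8 * (X + 1)) - 4 * e * X = 4 * (e * X) + 8 * e by ring.
by apply: ltr_wpDl; [apply: mulr_ge0|apply: mulr_gt0].
Qed.

End Green.
(** * Differentiation of functions of one complex variable *)

Section ComplexCalculus.
Variable R : realType.
Implicit Types (z w D : R[i]) (G H : R[i] -> R[i]).

Lemma is_derive_ext (K : numFieldType) (f g : K -> K) (x a b : K) :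
  f =1 g -> a = b -> is_derive x (1 : K) f a -> is_derive x (1 : K) g b.
Proof. by move=> /funext -> ->. Qed.

Lemma is_derive_chain (K : numFieldType) (f g : K -> K) (x a b : K) :
  is_derive (g x) (1 : K) f a -> is_derive x (1 : K) g b ->
  is_derive x (1 : K) (fun y => f (g y)) (a * b).
Proof.
move=> [/derivable1_diffP df fa] [/derivable1_diffP dg gb].
have dfg := differentiable_comp dg df.
split; first exact/derivable1_diffP.
have dgE : 'd g x 1 = b := etrans (esym (deriveE (1 : K) dg)) gb.
have dfE : 'd f (g x) 1 = a := etrans (esym (deriveE (1 : K) df)) fa.
apply: etrans (deriveE (1 : K) dfg) _.
apply: etrans (congr1 (fun L : K -> K => L 1) (diff_comp dg df)) _.
apply: etrans (congr1 ('d f (g x)) dgE) _.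
have bE : b = b *: (1 : K) by rewrite -[RHS]/(b * 1) mulr1.
apply: etrans (congr1 ('d f (g x)) bE) _.
apply: etrans (linearZ _ _) _.
by apply: etrans (congr1 (fun y : K => b * y) dfE) _; rewrite mulrC.
Qed.

Lemma differentiable_is_derive (K : numFieldType) (f : K -> K) (x : K) :
  differentiable f x -> is_derive x (1 : K) f ('D_1 f x).
Proof. by move=> /derivable1_diffP df; apply/derivableP. Qed.

Lemma is_derive_differentiable (K : numFieldType) (f : K -> K) (x a : K) :
  is_derive x (1 : K) f a -> differentiable f x.
Proof. by move=> [df _]; apply/derivable1_diffP. Qed.

Lemma is_derive_scale (K : numFieldType) (k x : K) : is_derive x (1 : K) ( *%R k) k.
Proof.
apply: (@is_derive_ext _ (k *: (id : K -> K)) _ _ (k *: (1 : K))) => //.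
by rewrite -[k *: 1]/(k * 1) mulr1.
Qed.

Lemma is_derive_prod (K : numFieldType) (f g : K -> K) (x a b : K) :
  is_derive x (1 : K) f a -> is_derive x (1 : K) g b ->
  is_derive x (1 : K) (fun y => f y * g y) (a * g x + f x * b).
Proof.
move=> df dg; apply: (@is_derive_ext _ (f * g) _ _ (f x *: b + g x *: a)) => //.
by rewrite addrC mulrC.
Qed.

Lemma nbhs_cmod w (P : R[i] -> Prop) :
  nbhs w P <-> exists2 d : R, 0 < d & forall z, cmod (z - w) < d -> P z.
Proof.
split.
- move=> /nbhs_normP[e /gt0_complexR[-> e0] h]; exists (complex.Re e) => // z zw.
  by apply: h; rewrite /= distrC cmodE ltcR.
- move=> [d d0 h]; apply/nbhs_normP; exists d%:C; first by rewrite /= ltcR.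
  by move=> z /=; rewrite distrC cmodE ltcR => /h.
Qed.

Lemma continuous_Re : continuous (@complex.Re R).
Proof.
move=> w P /nbhs_normP[e e0 h]; apply/nbhs_cmod; exists e => // z zw.
by apply: h; apply: le_lt_trans zw; rewrite distrC -raddfB; exact: cmod_Re.
Qed.

Lemma continuous_Im : continuous (@complex.Im R).
Proof.
move=> w P /nbhs_normP[e e0 h]; apply/nbhs_cmod; exists e => // z zw.
by apply: h; apply: le_lt_trans zw; rewrite distrC -raddfB; exact: cmod_Im.
Qed.

Lemma continuous_vertical (x : R) : continuous (fun y : R => x +i* y).
Proof.
move=> y P /nbhs_cmod[d d0 h]; apply/nbhs_normP; exists d => // z /= yz.
apply: h; apply: le_lt_trans yz.
apply: le_trans (cmod_ReIm _) _; rewrite /= subrr normr0 add0r.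
by rewrite distrC.
Qed.

Lemma continuous_horizontal (y : R) : continuous (fun x : R => x +i* y).
Proof.
move=> x P /nbhs_cmod[d d0 h]; apply/nbhs_normP; exists d => // z /= xz.
apply: h; apply: le_lt_trans xz.
apply: le_trans (cmod_ReIm _) _; rewrite /= subrr normr0 addr0.
by rewrite distrC.
Qed.

(** The Cauchy-Riemann equations, in the total differentials of the real and
    imaginary part. *)
Lemma total_diff_ReIm G w D : is_derive w (1 : R[i]) G D ->
  total_diff (fun x y => complex.Re (G (x +i* y))) (complex.Re D) (- complex.Im D)
    (complex.Re w) (complex.Im w) /\
  total_diff (fun x y => complex.Im (G (x +i* y))) (complex.Im D) (complex.Re D)
    (complex.Re w) (complex.Im w).
Proof.
move=> /is_derive_cmod dG.
have key e : 0 < e -> exists2 d : R, 0 < d & forall x y,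
    `|x - complex.Re w| <= d -> `|y - complex.Im w| <= d ->
    cmod (G (x +i* y) - G w - ((x - complex.Re w) +i* (y - complex.Im w)) * D) <=
    e * (`|x - complex.Re w| + `|y - complex.Im w|).
  move=> e0; have [d d0 h] := dG _ e0; exists (d / 2); first exact: divr_gt0.
  move=> x y hx hy.
  have hc := cmod_ReIm ((x - complex.Re w) +i* (y - complex.Im w)).
  have := h ((x - complex.Re w) +i* (y - complex.Im w)).
  have -> : w + ((x - complex.Re w) +i* (y - complex.Im w)) = x +i* y.
    by case: w {dG h hx hy hc} => a b; simpc; rewrite /= ![_ + (_ - _)]addrC !subrK.
  move=> /(_ _)/le_trans; apply; last by rewrite ler_pM2l.
  by apply: le_trans hc _; rewrite /=; lra.
have Gw : G (complex.Re w +i* complex.Im w) = G w by case: w {dG key}.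
split=> e e0; have [d d0 h] := key _ e0; exists d => // x y hx hy.
- apply: le_trans (h _ _ hx hy); rewrite Gw; apply: le_trans (cmod_Re _).
  rewrite !raddfB /=; case: D {dG key h} => a b /=.
  by rewrite le_eqVlt; apply/orP; left; apply/eqP; congr `|_|; ring.
- apply: le_trans (h _ _ hx hy); rewrite Gw; apply: le_trans (cmod_Im _).
  rewrite !raddfB /=; case: D {dG key h} => a b /=.
  by rewrite le_eqVlt; apply/orP; left; apply/eqP; congr `|_|; ring.
Qed.

Lemma differentiable_cexp w : differentiable (@cexp R) w.
Proof. exact: is_derive_differentiable (is_derive_cexp w). Qed.

Lemma continuous_cexp : continuous (@cexp R).
Proof. move=> w; exact: differentiable_continuous (differentiable_cexp w). Qed.

End ComplexCalculus.

(** * Means over circles and Taylor coefficients *)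

Section CircleMean.
Variable R : realType.
Implicit Types (h : R -> R[i]) (G : R[i] -> R[i]).

Let tau : R := pi *+ 2.

Let tau_gt0 : 0 < tau. Proof. by rewrite mulrn_wgt0 // pi_gt0. Qed.

Definition cmean h : R[i] :=
  (rint (fun t => complex.Re (h t)) 0 (pi *+ 2) / (pi *+ 2)) +i*
  (rint (fun t => complex.Im (h t)) 0 (pi *+ 2) / (pi *+ 2)).

Let continuous_Re_comp h : continuous h -> continuous (fun t => complex.Re (h t)).
Proof. by move=> ch t; apply: continuous_comp; [exact: ch|exact: continuous_Re]. Qed.

Let continuous_Im_comp h : continuous h -> continuous (fun t => complex.Im (h t)).
Proof. by move=> ch t; apply: continuous_comp; [exact: ch|exact: continuous_Im]. Qed.

Lemma cmean_linear (a : R[i]) h1 h2 : continuous h1 -> continuous h2 ->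
  cmean (fun t => a * h1 t + h2 t) = a * cmean h1 + cmean h2.
Proof.
move=> c1 c2; case: a => a b.
have r1 := continuous_Re_comp c1; have r2 := continuous_Re_comp c2.
have i1 := continuous_Im_comp c1; have i2 := continuous_Im_comp c2.
have cZ (k : R) f : continuous f -> continuous (fun t : R => k * f t).
  by move=> cf t; apply: cvgM; [exact: cvg_cst|exact: cf].
have cD (f g : R -> R) : continuous f -> continuous g -> continuous (fun t => f t + g t).
  by move=> cf cg t; apply: cvgD; [exact: cf|exact: cg].
rewrite /cmean -/tau.
have -> : rint (fun t => complex.Re ((a +i* b) * h1 t + h2 t)) 0 tau =
    a * rint (fun t => complex.Re (h1 t)) 0 tau +
    (- b) * rint (fun t => complex.Im (h1 t)) 0 tau +
    rint (fun t => complex.Re (h2 t)) 0 tau.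
  rewrite -!rintZ // -!rintD //; try by [apply: cZ|apply: cD; apply: cZ].
  by apply: eq_rint => t _; rewrite raddfD /=; case: (h1 t) => u v /=; ring.
have -> : rint (fun t => complex.Im ((a +i* b) * h1 t + h2 t)) 0 tau =
    a * rint (fun t => complex.Im (h1 t)) 0 tau +
    b * rint (fun t => complex.Re (h1 t)) 0 tau +
    rint (fun t => complex.Im (h2 t)) 0 tau.
  rewrite -!rintZ // -!rintD //; try by [apply: cZ|apply: cD; apply: cZ].
  by apply: eq_rint => t _; rewrite raddfD /=; case: (h1 t) => u v /=; ring.
by simpc; apply/eqP; rewrite eq_complex /=; apply/andP; split; apply/eqP; ring.
Qed.

(** The factor [2] comes from treating real and imaginary part separately. *)
Lemma cmean_close h (k : R[i]) (E : R) : continuous h ->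
  (forall t, 0 <= t <= pi *+ 2 -> cmod (h t - k) <= E) -> cmod (cmean h - k) <= 2 * E.
Proof.
move=> ch hE; apply: le_trans (cmod_ReIm _) _.
have tau0 := ltW tau_gt0.
have hr := @rint_close R _ (complex.Re k) E 0 tau (continuous_Re_comp ch) tau0.
have hi := @rint_close R _ (complex.Im k) E 0 tau (continuous_Im_comp ch) tau0.
have {}hr := hr (fun t ht => le_trans _ (hE t ht)).
have {}hi := hi (fun t ht => le_trans _ (hE t ht)).
rewrite subr0 in hr hi.
have scale (x y : R) : `|x - y * tau| <= E * tau -> `|x / tau - y| <= E.
  rewrite -ler_pdivrMr // => h1; apply: le_trans h1.
  rewrite -[X in _ <= _ / X]gtr0_norm // -normf_div mulrBl mulfK ?gt_eqF //.
rewrite raddfB /= raddfB /= mulr2n mulrDl mul1r lerD //; apply: scale.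
- by apply: hr => t; rewrite -raddfB; exact: cmod_Re.
- by apply: hi => t; rewrite -raddfB; exact: cmod_Im.
Qed.

(** Goursat's theorem on the rectangle with corners [s] and [s' + 2 pi i], whose
    horizontal sides cancel by periodicity. For functions of [exp w] this is the
    independence of circular means of the radius. *)
Lemma cmean_vertical_shift G (s s' : R) :
  (forall w, differentiable G w) -> (forall w, G (w + (0 +i* (pi *+ 2))) = G w) ->
  cmean (fun t => G (s +i* t)) = cmean (fun t => G (s' +i* t)).
Proof.
move=> dG perG; wlog ss : s s' / s <= s'.
  by move=> W; have [|/ltW] := leP s s' => /W.
have tau0 := ltW tau_gt0.
have cG : continuous G by move=> w; exact: differentiable_continuous.
have cv x : continuous (fun y : R => G (x +i* y)).
  by move=> y; apply: continuous_comp; [exact: continuous_vertical|exact: cG].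
have chz y : continuous (fun x : R => G (x +i* y)).
  by move=> x; apply: (@continuous_comp _ _ _ (fun x : R => x +i* y) G);
    [exact: continuous_horizontal|exact: cG].
have tot x y : exists D,
    total_diff (fun x y => complex.Re (G (x +i* y))) (complex.Re D) (- complex.Im D) x y /\
    total_diff (fun x y => complex.Im (G (x +i* y))) (complex.Im D) (complex.Re D) x y.
  by have := total_diff_ReIm (differentiable_is_derive (dG (x +i* y))); exists ('D_1 G (x +i* y)).
have per x : G (x +i* tau) = G (x +i* 0) by rewrite -[RHS]perG; congr G; simpc.
have zero (q : R -> R -> R) : (forall x, q x tau = q x 0) ->
    rint (fun x => q x tau - q x 0) s s' = 0.
  move=> hq; rewrite (@eq_rint _ _ (fun=> 0)) ?rint_cst ?mul0r // => x _.
  by rewrite hq subrr.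
rewrite /cmean -/tau; congr ((_ / _) +i* (_ / _)); apply/esym/eqP; rewrite -subr_eq0; apply/eqP.
- rewrite -rintB; try exact: continuous_Re_comp.
  rewrite (@green_rectangle _ (fun x y => complex.Re (G (x +i* y)))
      (fun x y => complex.Im (G (x +i* y)))) //.
  + by apply: (zero (fun x y => complex.Im (G (x +i* y)))) => x; rewrite per.
  + by move=> x; exact: continuous_Re_comp.
  + by move=> y; apply: (@continuous_Im_comp (fun x : R => G (x +i* y))).
  + move=> x y; have [D [h1 h2]] := tot x y.
    by exists (complex.Re D), (- complex.Im D), (complex.Im D).
- rewrite -rintB; try exact: continuous_Im_comp.
  rewrite (@green_rectangle _ (fun x y => complex.Im (G (x +i* y)))
      (fun x y => - complex.Re (G (x +i* y)))) //.
  + by apply: (zero (fun x y => - complex.Re (G (x +i* y)))) => x; rewrite per.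
  + by move=> x; exact: continuous_Im_comp.
  + move=> y x; apply: cvgN.
    exact: (@continuous_Re_comp (fun x : R => G (x +i* y)) (chz y) x).
  + move=> x y; have [D [h1 h2]] := tot x y.
    exists (complex.Im D), (complex.Re D), (- complex.Re D); split; first exact: h2.
    move=> e e0; have [d d0 hd] := h1 _ e0; exists d => // x' y' hx hy.
    apply: le_trans (hd _ _ hx hy); rewrite -normrN.
    by rewrite le_eqVlt; apply/orP; left; apply/eqP; congr `|_| => /=; ring.
Qed.

(** The derivative of [G] along the vertical segment from [0] to [2 pi i] is
    ['i * G'], whose integral is the increment of a periodic function. *)
Lemma cmean_derivative G (G' : R[i] -> R[i]) :
  (forall w, is_derive w (1 : R[i]) G (G' w)) -> continuous G' ->
  (forall w, G (w + (0 +i* (pi *+ 2))) = G w) ->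
  cmean (fun t => G' (0 +i* t)) = 0.
Proof.
move=> dG cG' perG.
have cv : continuous (fun y : R => G' (0 +i* y)).
  by move=> y; apply: continuous_comp; [exact: continuous_vertical|exact: cG'].
have pathE t : (0 : R[i]) + t%:C * 'i%C = 0 +i* t by simpc.
have per : G (0 +i* tau) = G (0 +i* 0) by rewrite -[RHS]perG; congr G; simpc.
have dRe t : is_derive t (1 : R) (fun s : R => complex.Re (G (0 +i* s)))
    (- complex.Im (G' (0 +i* t))).
  have := @is_derive_Re_line R G 0 'i%C t (G' (0 +i* t)); rewrite pathE => /(_ (dG _)).
  apply: is_derive_ext => [s|]; first by rewrite pathE.
  by case: (G' _) => u v /=; rewrite mul0r mul1r sub0r.
have dIm t : is_derive t (1 : R) (fun s : R => complex.Im (G (0 +i* s)))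
    (complex.Re (G' (0 +i* t))).
  have dg : is_derive ((0 : R[i]) + t%:C * 'i%C) (1 : R[i]) (fun w => - 'i%C * G w)
      (- 'i%C * G' (0 +i* t)).
    rewrite pathE; apply: is_derive_ext (is_derive_chain (is_derive_scale _ _) (dG _)) => //.
  apply: is_derive_ext (is_derive_Re_line dg) => [s|].
    by rewrite pathE; case: (G _) => u v /=; rewrite oppr0; ring.
  by case: (G' _) => u v /=; rewrite oppr0; ring.
have i0 : rint (fun t => complex.Re (G' (0 +i* t))) 0 tau = 0.
  by rewrite (rint_derive tau_gt0 _ dIm) ?per ?subrr //; exact: continuous_Re_comp.
have r0 : rint (fun t => complex.Im (G' (0 +i* t))) 0 tau = 0.
  have ci := continuous_Im_comp cv.
  have cNi : continuous (fun t => - complex.Im (G' (0 +i* t))).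
    by move=> t; apply: cvgN; exact: ci.
  have := rint_derive tau_gt0 cNi dRe; rewrite per subrr => h.
  have : -1 * rint (fun t => complex.Im (G' (0 +i* t))) 0 tau = 0.
    by rewrite -rintZ // -[RHS]h; apply: eq_rint => x _; rewrite mulN1r.
  by move/eqP; rewrite mulN1r oppr_eq0 => /eqP.
by rewrite /cmean -/tau i0 r0 !mul0r.
Qed.

End CircleMean.
Section TaylorCoefficients.
Variable R : realType.
Implicit Types (g : R[i] -> R[i]) (w z : R[i]) (s M : R) (k : nat).

Lemma differentiable_mull g (a z : R[i]) :
  differentiable g z -> differentiable (fun y => a * g y) z.
Proof.
move=> /differentiable_is_derive dg.
exact: is_derive_differentiable (is_derive_chain (is_derive_scale a _) dg).
Qed.

Lemma cexp_natmul k z : cexp (k%:R * z) = cexp z ^+ k.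
Proof.
elim: k => [|k ih]; first by rewrite mul0r cexp0 expr0.
by rewrite -natr1 mulrDl mul1r cexpD ih exprSr.
Qed.

Lemma cexp_period w : cexp (w + (0 +i* (pi *+ 2))) = cexp w.
Proof. by rewrite cexpD {2}/cexp /= expR0 cos2pi sin2pi mul1r mulr1. Qed.

(** In the logarithmic coordinate [w], the integrand of Cauchy's formula for
    the [k]-th Taylor coefficient of [g] at [0]. *)
Definition cauchy_integrand k g w : R[i] := g (cexp w) * cexp (- (k%:R * w)).

(** Cauchy's formula on the unit circle, which defines a linear functional
    without any reference to higher derivatives. *)
Definition taylor_coef k g : R[i] := cmean (fun t => cauchy_integrand k g (0 +i* t)).

Lemma is_derive_cauchy_integrand k g (g' : R[i] -> R[i]) w :
  (forall z, is_derive z (1 : R[i]) g (g' z)) ->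
  is_derive w (1 : R[i]) (cauchy_integrand k g)
    (g' (cexp w) * cexp w * cexp (- (k%:R * w)) - k%:R * cauchy_integrand k g w).
Proof.
move=> dg.
have d1 := is_derive_chain (dg (cexp w)) (is_derive_cexp w).
have d2 := is_derive_chain (is_derive_cexp (- k%:R * w)) (is_derive_scale (- k%:R) w).
apply: is_derive_ext (is_derive_prod d1 d2) => [z|].
  by rewrite /cauchy_integrand mulNr.
by rewrite /cauchy_integrand mulNr; ring.
Qed.

Lemma differentiable_cauchy_integrand k g : (forall z, differentiable g z) ->
  forall w, differentiable (cauchy_integrand k g) w.
Proof.
move=> dg w; apply: is_derive_differentiable.
exact: is_derive_cauchy_integrand (fun z => differentiable_is_derive (dg z)).
Qed.

Lemma cauchy_integrand_period k g w :
  cauchy_integrand k g (w + (0 +i* (pi *+ 2))) = cauchy_integrand k g w.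
Proof.
rewrite /cauchy_integrand cexp_period; congr (_ * _).
have T1 : cexp (k%:R * (0 +i* (pi *+ 2)) : R[i]) = 1.
  by rewrite cexp_natmul -[_ +i* _]add0r cexp_period cexp0 expr1n.
have T2 : cexp (- (k%:R * (0 +i* (pi *+ 2))) : R[i]) = 1.
  by rewrite -[LHS]mul1r -{1}T1 -cexpD subrr cexp0.
by rewrite mulrDr opprD cexpD T2 mulr1.
Qed.

Lemma continuous_cauchy_integrand k g s : (forall z, differentiable g z) ->
  continuous (fun t : R => cauchy_integrand k g (s +i* t)).
Proof.
move=> dg t; apply: continuous_comp; first exact: continuous_vertical.
exact: differentiable_continuous (differentiable_cauchy_integrand k dg _).
Qed.

Lemma taylor_coef_shift k g s : (forall z, differentiable g z) ->
  taylor_coef k g = cmean (fun t => cauchy_integrand k g (s +i* t)).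
Proof.
move=> dg; apply: cmean_vertical_shift.
- exact: differentiable_cauchy_integrand.
- exact: cauchy_integrand_period.
Qed.

Lemma taylor_coef_linear k (a : R[i]) g1 g2 :
  (forall z, differentiable g1 z) -> (forall z, differentiable g2 z) ->
  taylor_coef k (fun z => a * g1 z + g2 z) = a * taylor_coef k g1 + taylor_coef k g2.
Proof.
move=> d1 d2; rewrite /taylor_coef -cmean_linear; try exact: continuous_cauchy_integrand.
by congr cmean; apply/funext => t; rewrite /cauchy_integrand; ring.
Qed.

Lemma taylor_coef_scale k (a : R[i]) g : (forall z, differentiable g z) ->
  taylor_coef k (fun z => a * g z) = a * taylor_coef k g.
Proof.
move=> dg; have d0 (z : R[i]) : differentiable (fun=> 0 : R[i]) z by exact: differentiable_cst.
have coef0 : taylor_coef k (fun=> 0 : R[i]) = 0.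
  have := taylor_coef_linear k 1 d0 d0.
  have -> : (fun=> 1 * 0 + 0) = (fun=> 0) :> (R[i] -> R[i]).
    by apply/funext => z; rewrite mul1r addr0.
  by move=> /eqP; rewrite mul1r addrC -subr_eq subrr eq_sym => /eqP.
have -> : (fun z => a * g z) = (fun z => a * g z + 0) by apply/funext => z; rewrite addr0.
by rewrite taylor_coef_linear // coef0 addr0.
Qed.

(** Cauchy's estimate on the circle of radius [expR s], for every [s]: this is
    what makes the coefficients functionals supported at the origin. *)
Lemma cauchy_estimate k g s M : (forall z, differentiable g z) ->
  (forall t, 0 <= t <= pi *+ 2 -> cmod (g (cexp (s +i* t))) <= M) ->
  cmod (taylor_coef k g) <= 2 * (M * expR (- (k%:R * s))).
Proof.
move=> dg gM; rewrite (taylor_coef_shift k s dg) -[cmean _]subr0.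
apply: cmean_close; first exact: continuous_cauchy_integrand.
move=> t ht; rewrite subr0 /cauchy_integrand cmodM [cmod (cexp (- _))]cmod_cexp.
have -> : complex.Re (- (k%:R * (s +i* t))) = - (k%:R * s).
  by rewrite -[k%:R]/((k%:R : R[i])) -(rmorph_nat (@real_complex R)) /= mul0r subr0.
by rewrite ler_wpM2r ?expR_ge0 // gM.
Qed.

(** The circle of integration shrinks to the center. *)
Lemma taylor_coef0 g : (forall z, differentiable g z) -> taylor_coef 0 g = g 0.
Proof.
move=> dg; apply/eqP; rewrite -subr_eq0 -cmod_eq0; apply/eqP/le_anti.
rewrite cmod_ge0 andbT; apply/ler_addgt0Pl => e e0; rewrite addr0.
have cg : {for 0, continuous g} by exact: differentiable_continuous (dg 0).
have e2 : 0 < (e / 2)%:C by rewrite ltcR divr_gt0.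
have /nbhs_cmod[d d0 h] : nbhs (0 : R[i]) (fun z => cmod (g z - g 0) <= e / 2).
  have : nbhs (g 0) (fun y => cmod (y - g 0) <= e / 2).
    by apply/nbhs_cmod; exists (e / 2) => [|z /ltW //]; rewrite divr_gt0.
  exact: cg.
have hd : 0 < d / 2 by rewrite divr_gt0.
rewrite (taylor_coef_shift 0 (ln (d / 2)) dg).
apply: le_trans (cmean_close (E := e / 2) _ _) _.
- exact: continuous_cauchy_integrand.
- move=> t _; rewrite /cauchy_integrand mul0r oppr0 cexp0 mulr1; apply: h.
  by rewrite subr0 cmod_cexp /= lnK // ltr_pdivrMr // ltr_pMr // ltr1n.
- by rewrite mulrC divfK.
Qed.

(** Integration by parts on the unit circle. *)
Lemma taylor_coefS k g (g' : R[i] -> R[i]) :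
  (forall z, is_derive z (1 : R[i]) g (g' z)) -> (forall z, differentiable g' z) ->
  taylor_coef k g' = k.+1%:R * taylor_coef k.+1 g.
Proof.
move=> dg dg'.
have dg1 z : differentiable g z := is_derive_differentiable (dg z).
pose H w := (- k.+1%:R) * cauchy_integrand k.+1 g w + cauchy_integrand k g' w.
have dH w : is_derive w (1 : R[i]) (cauchy_integrand k.+1 g) (H w).
  apply: is_derive_ext (is_derive_cauchy_integrand k.+1 w dg) => //.
  have E : cexp w * cexp (- (k.+1%:R * w)) = cexp (- (k%:R * w)).
    by rewrite -cexpD -natr1; congr cexp; ring.
  by rewrite /H /cauchy_integrand -mulrA E; ring.
have cH : continuous H.
  move=> w; apply: differentiable_continuous; rewrite /H.
  apply: differentiableD; last exact: differentiable_cauchy_integrand.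
  exact/differentiable_mull/differentiable_cauchy_integrand.
have := cmean_derivative dH cH (cauchy_integrand_period _ _).
rewrite /H cmean_linear; try exact: continuous_cauchy_integrand.
by rewrite -!/(taylor_coef _ _) mulNr addrC => /eqP; rewrite subr_eq0 => /eqP.
Qed.

Lemma is_derive_cexpM w z : is_derive z (1 : R[i]) (fun y => cexp (y * w)) (w * cexp (z * w)).
Proof.
apply: is_derive_ext (is_derive_chain (is_derive_cexp (w * z)) (is_derive_scale w z)).
- by move=> y /=; rewrite mulrC.
- by rewrite mulrC [w * z]mulrC.
Qed.

Lemma taylor_coef_cexp k w : taylor_coef k (fun z => cexp (z * w)) = w ^+ k / k`!%:R.
Proof.
have d z := is_derive_differentiable (is_derive_cexpM w z).
elim: k => [|k ih]; first by rewrite taylor_coef0 // mul0r cexp0 expr0 divr1.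
have d' z : differentiable (fun z => w * cexp (z * w)) z.
  exact/differentiable_mull/d.
have := taylor_coefS k (is_derive_cexpM w) d'.
rewrite taylor_coef_scale // ih => E; apply: (mulfI (x := k.+1%:R)); first by rewrite pnatr_eq0.
rewrite -E exprS factS natrM.
have : (k.+1%:R : R[i]) != 0 by rewrite pnatr_eq0.
have : (k`!%:R : R[i]) != 0 by rewrite pnatr_eq0 -lt0n fact_gt0.
by move: (k.+1%:R : R[i]) (k`!%:R : R[i]) => a b b0 a0; field; rewrite a0 b0.
Qed.

End TaylorCoefficients.
(** * Entire functions and analytic functionals *)

Section EntireFunctions.
Variables (R : realType) (n : nat).
Implicit Types (xi v l : 'rV[R[i]]_n) (z : 'cV[R[i]]_n) (f g : 'rV[R[i]]_n -> R[i]).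

Lemma pairingE xi z : pairing xi z = \sum_(j < n) xi ord0 j * z j ord0.
Proof. by rewrite /pairing mxE. Qed.

Lemma pairingDl xi v z : pairing (xi + v) z = pairing xi z + pairing v z.
Proof. by rewrite /pairing mulmxDl mxE. Qed.

Lemma pairingZl (a : R[i]) xi z : pairing (a *: xi) z = a * pairing xi z.
Proof. by rewrite /pairing -scalemxAl mxE. Qed.

Lemma pairingZr (a : R[i]) xi z : pairing xi (a *: z) = a * pairing xi z.
Proof. by rewrite /pairing -scalemxAr mxE. Qed.

Lemma pairing_delta j z : pairing (delta_mx ord0 j) z = z j ord0.
Proof.
rewrite pairingE (bigD1 j) //= mxE !eqxx mul1r big1 ?addr0 // => i ij.
by rewrite mxE (negbTE ij) andbF mul0r.
Qed.

Lemma entire_linear (a : R[i]) f g : entire f -> entire g -> entire (a *: f + g).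
Proof.
move=> ef eg xi; apply: differentiableD; last exact: eg.
exact: differentiableZ.
Qed.

Lemma differentiable_pairing z xi : differentiable (fun xi => pairing xi z) xi.
Proof.
have -> : (fun xi => pairing xi z) =
    \sum_(j < n) (fun xi : 'rV[R[i]]_n => z j ord0 *: (xi ord0 j : R[i])).
  apply/funext => v; rewrite fct_sumE pairingE; apply: eq_bigr => j _.
  by rewrite mulrC.
apply: differentiable_sum => j.
exact/differentiableZ/differentiable_coord.
Qed.

Lemma entire_exponential z : entire (fun xi => cexp (pairing xi z)).
Proof.
move=> xi; apply: (@differentiable_comp _ _ _ _ (fun xi => pairing xi z) (@cexp R)).
  exact: differentiable_pairing.
exact: differentiable_cexp.
Qed.

Lemma differentiable_line xi v (w : R[i]) : differentiable (fun y : R[i] => xi + y *: v) w.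
Proof.
apply: (@differentiableD _ _ _ (cst xi) (fun y : R[i] => y *: v)).
  exact: differentiable_cst.
by apply: (@differentiableZl _ _ _ (id : R[i] -> R[i]) v).
Qed.

Lemma differentiable_entire_line f xi v :
  entire f -> forall w : R[i], differentiable (fun y : R[i] => f (xi + y *: v)) w.
Proof.
move=> ef w; apply: (@differentiable_comp _ _ _ _ (fun y : R[i] => xi + y *: v) f).
  exact: differentiable_line.
exact: ef.
Qed.

End EntireFunctions.

Section SupportedFunctionals.
Variables (R : realType) (n : nat).
Notation rV := 'rV[R[i]]_n.
Notation cV := 'cV[R[i]]_n.
Implicit Types (mu : (rV -> R[i]) -> R[i]) (S U : set rV) (K : set rV) (F G : cV -> R[i]).

(** [mu] is bounded by a multiple of the supremum over [S]; an upper bound [M]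
    stands for the supremum, which may be infinite. *)
Definition bounded_on S mu : Prop := exists2 C : R, 0 <= C &
  forall f, entire f -> forall M, 0 <= M -> (forall x, S x -> cmod (f x) <= M) ->
    cmod (mu f) <= C * M.

Lemma bounded_on_sub S U mu : S `<=` U -> bounded_on S mu -> bounded_on U mu.
Proof.
move=> SU [C C0 h]; exists C => // f ef M M0 fM.
by apply: h => // x /SU; exact: fM.
Qed.

Lemma bounded_on_linear S (a : R[i]) mu nu : bounded_on S mu -> bounded_on S nu ->
  bounded_on S (fun f => a * mu f + nu f).
Proof.
move=> [C C0 h] [D D0 k]; exists (cmod a * C + D).
  by rewrite addr_ge0 // mulr_ge0 ?cmod_ge0.
move=> f ef M M0 fM; apply: le_trans (cmodD _ _) _; rewrite cmodM mulrDl -mulrA.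
by apply: lerD; [rewrite ler_wpM2l ?cmod_ge0 // h | exact: k].
Qed.

(** Continuity and support are both expressed by bounds, which are stable under
    linear combinations. *)
Definition supported_functional K mu : Prop :=
  [/\ forall (a : R[i]) f g, entire f -> entire g -> mu (a *: f + g) = a * mu f + mu g,
      exists2 Q, compact Q & bounded_on Q mu &
      forall U, open U -> K `<=` U -> bounded_on U mu].

(** The bound by the supremum over a compact set is continuity for uniform
    convergence on compact sets. *)
Lemma supported_functional_analytic K mu :
  supported_functional K mu -> analytic_functional mu.
Proof.
move=> [lin [Q cQ [C C0 muC]] _]; split=> //.
apply/subspace_continuousP => f /= ef P /nbhs_cmod[e e0 Pe].
pose d := e / (C + 1).
have C1 : 0 < C + 1 by rewrite ltr_wpDl.
have d0 : 0 < d by rewrite divr_gt0.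
have d0' : 0 < d%:C by rewrite ltcR.
have ent := entourage_ball R[i] (PosNum d0').
have := @fam_nbhs rV R[i] compact Q _ (f : {family compact, rV -> R[i]}) ent cQ.
rewrite /= => near_f; rewrite /= nbhs_simpl /within /=.
apply: filterS near_f => g /= fg eg; apply: Pe.
have -> : mu g - mu f = mu ((-1) *: f + g) by rewrite lin // mulN1r addrC.
have : cmod (mu ((-1) *: f + g)) <= C * d.
  apply: muC => [||x Qx]; [exact: entire_linear|exact: ltW|].
  have := fg _ Qx; rewrite -ball_normE /= cmodE ltcR => /ltW.
  suff -> : (-1 *: f + g) x = - (f x - g x) by rewrite cmodN.
  by rewrite fctE /= scaleN1r opprB addrC.
move=> /le_lt_trans; apply.
by rewrite /d mulrA ltr_pdivrMr // mulrDr mulr1 mulrC ltrDl.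
Qed.

Lemma supported_functional_support K mu : compact K -> K !=set0 ->
  supported_functional K mu -> is_support K mu.
Proof.
move=> cK [x0 Kx0] [_ _ h]; split=> // U oU KU; have [C C0 muC] := h U oU KU.
exists (C + 1) => [|f ef]; first exact: addr_ge0.
set A := [set _ | _ in _]; set s := ereal_sup A.
have fs x : U x -> ((cmod (f x))%:E <= s)%E by move=> Ux; apply: ereal_sup_ubound; exists x.
have C1 : 0 < C + 1 by rewrite ltr_wpDl.
have := fs _ (KU _ Kx0); case: s fs => [r||] fs.
- rewrite lee_fin => x0r; have r0 := le_trans (cmod_ge0 _) x0r.
  rewrite -EFinM lee_fin; apply: le_trans (muC f ef r r0 _) _.
    by move=> x /fs; rewrite lee_fin.
  by rewrite ler_wpM2r // lerDl.
- by move=> _; rewrite gt0_muley ?lte_fin // leey.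
- by rewrite leNgt ltNyr.
Qed.

Definition supported_transform K : set (cV -> R[i]) :=
  [set F | exists2 mu, supported_functional K mu & F = borel_fourier mu].

Lemma supported_transform_Shat K : compact K -> K !=set0 -> supported_transform K `<=` Shat K.
Proof.
move=> cK K0 F [mu smu ->]; exists mu; split=> //.
- exact: supported_functional_analytic smu.
- exact: supported_functional_support.
Qed.

Lemma supported_transform0 K : supported_transform K 0.
Proof.
exists (fun=> 0); last by [].
split=> [a f g _ _||U _ _]; first by rewrite mulr0 addr0.
- exists set0; first exact: compact0.
  by exists 0 => // f _ M M0 _; rewrite cmod0 mul0r.
- by exists 0 => // f _ M M0 _; rewrite cmod0 mul0r.
Qed.

Lemma supported_transform_linear K (a : R[i]) F G :
  supported_transform K F -> supported_transform K G -> supported_transform K (a *: F + G).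
Proof.
move=> [mu [lmu [Q cQ bQ] bmu] ->] [nu [lnu [S cS bS] bnu] ->].
exists (fun f => a * mu f + nu f) => //; split.
- by move=> c f g ef eg; rewrite lmu // lnu //; ring.
- exists (Q `|` S); first exact: compactU.
  apply: bounded_on_linear; [apply: bounded_on_sub bQ|apply: bounded_on_sub bS].
    exact: subsetUl.
  exact: subsetUr.
- by move=> U oU KU; apply: bounded_on_linear; [exact: bmu|exact: bnu].
Qed.

(** The functional is, up to the factor [k!], the [k]-th derivative at [xi] in the
    direction [l], written as a Cauchy integral over a circle in the complex line through [xi]. By
    Cauchy's estimate the circle can be shrunk into any neighborhood of [xi]. *)
Lemma power_exponential_supported K (xi l : rV) k : K xi ->
  supported_transform K (fun z => pairing l z ^+ k * cexp (pairing xi z)).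
Proof.
move=> Kxi; pose mu (f : rV -> R[i]) := taylor_coef k (fun y => f (xi + y *: l)).
have lin (a : R[i]) f g : entire f -> entire g -> mu (a *: f + g) = a * mu f + mu g.
  move=> ef eg; rewrite /mu -taylor_coef_linear //; exact: differentiable_entire_line.
have bnd s (S : set rV) : (forall t, 0 <= t <= pi *+ 2 -> S (xi + cexp (s +i* t) *: l)) ->
    bounded_on S mu.
  move=> hS; exists (2 * expR (- (k%:R * s))); first by rewrite mulr_ge0 ?expR_ge0.
  move=> f ef M M0 fM; rewrite -mulrA [_ * M]mulrC.
  apply: cauchy_estimate; first exact: differentiable_entire_line.
  by move=> t /hS /fM.
have smu : supported_functional K mu.
  split=> // [|U oU KU].
  - exists ((fun t : R => xi + cexp (0 +i* t) *: l) @` `[0, pi *+ 2]).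
      apply: continuous_compact; last exact: segment_compact.
      apply: continuous_subspaceT => t.
      apply: (@continuous_comp _ _ _ (fun t : R => cexp (0 +i* t)) (fun y => xi + y *: l)).
        apply: (@continuous_comp _ _ _ (fun t : R => 0 +i* t) (@cexp R)).
          exact: continuous_vertical.
        exact: continuous_cexp.
      exact: differentiable_continuous (differentiable_line _ _ _).
    by apply: (bnd 0) => t ht; exists t => //; rewrite /= in_itv.
  - have cl : {for (0 : R[i]), continuous (fun y : R[i] => xi + y *: l)}.
      exact: differentiable_continuous (differentiable_line _ _ _).
    have /cl/nbhs_cmod[d d0 hd] : nbhs (xi + (0 : R[i]) *: l) U.
      by apply: open_nbhs_nbhs; split=> //; apply: KU; rewrite scale0r addr0.
    (* The circle of radius d / 2 lies in the open disk of radius d. *)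
    apply: (bnd (ln (d / 2))) => t _; apply: hd.
    by rewrite subr0 cmod_cexp /= lnK ?posrE ?divr_gt0 // ltr_pdivrMr // ltr_pMr // ltr1n.
have := supported_transform_linear k`!%:R (ex_intro2 _ _ mu smu erefl) (supported_transform0 K).
congr (supported_transform K _); apply/funext => z.
rewrite fctE /= addr0 /borel_fourier /mu.
rewrite -[LHS]/(k`!%:R * taylor_coef k (fun y : R[i] => cexp (pairing (xi + y *: l) z))).
have -> : taylor_coef k (fun y => cexp (pairing (xi + y *: l) z)) =
    taylor_coef k (fun y => cexp (pairing xi z) * cexp (y * pairing l z)).
  by congr taylor_coef; apply/funext => y; rewrite -cexpD pairingDl pairingZl.
rewrite taylor_coef_scale => [|y]; last exact: is_derive_differentiable (is_derive_cexpM _ _).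
rewrite taylor_coef_cexp.
have : (k`!%:R : R[i]) != 0 by rewrite pnatr_eq0 -lt0n fact_gt0.
by move: (k`!%:R : R[i]) => a a0; field.
Qed.

End SupportedFunctionals.
(** * Quasi-polynomials *)

Section QuasiPolynomials.

(** For a polynomial [Q] of degree at most [d], the polynomial
    [Q (2 s) - 2 ^ d Q s] has smaller degree, and its coefficients are nonzero
    multiples of the lower coefficients of [Q]. *)
Lemma coefficient_in_subspace (F : numFieldType) (V : lmodType F) (W : set V) :
  W 0 -> (forall (a : F) (x y : V), W x -> W y -> W (a *: x + y)) ->
  forall (d : nat) (c : nat -> V), (forall s : F, W (\sum_(j < d) s ^+ j *: c j)) ->
  forall j : nat, (j < d)%N -> W (c j).
Proof.
move=> W0 Wlin.
have WZ (a : F) x : W x -> W (a *: x) by move=> Wx; rewrite -[_ *: _]addr0; exact: Wlin.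
elim=> [//|d ih] c Wc.
have low j : (j < d)%N -> W (c j).
  move=> jd; have p0 : (2 ^+ j - 2 ^+ d : F) != 0.
    by rewrite subr_eq0 -!natrX eqr_nat eqn_exp2l // ltn_eqF.
  suff : W ((2 ^+ j - 2 ^+ d : F) *: c j).
    by move=> /(WZ (2 ^+ j - 2 ^+ d)^-1); rewrite scalerA mulVf // scale1r.
  apply: (ih (fun j => (2 ^+ j - 2 ^+ d : F) *: c j)) => // s.
  have := Wlin (- 2 ^+ d) _ _ (Wc s) (Wc (2 * s)).
  congr (W _); rewrite scaler_sumr -big_split /= big_ord_recr /= exprMn.
  rewrite !scalerA -scalerDl mulNr addNr scale0r addr0; apply: eq_bigr => i _.
  by rewrite !scalerA -scalerDl exprMn; congr (_ *: _); ring.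
move=> j; rewrite ltnS leq_eqVlt => /predU1P[->|/low //].
have Wsum : W (\sum_(i < d) c i).
  have : forall i : 'I_d, W (c i) by move=> i; apply: low.
  move=> Wi; elim/big_ind : _ => // x y Wx Wy.
  by rewrite -[x]scale1r; exact: Wlin.
have := Wlin (-1) _ _ Wsum (Wc 1); congr (W _).
rewrite big_ord_recr /= expr1n scale1r scaleN1r addrA.
under [X in _ + X + _]eq_bigr do rewrite expr1n scale1r.
by rewrite addNr add0r.
Qed.

Variables (R : realType) (n : nat) (K : set 'rV[R[i]]_n).
Notation rV := 'rV[R[i]]_n.
Notation cV := 'cV[R[i]]_n.
Implicit Types (xi a l : rV) (P : cV -> R[i]).

(** Invariance of [supported_transform K] under multiplication of the power
    [l ^ k] by a linear form [a] is polarization: it follows from the case of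
    [(l + s a) ^ k.+1], which is a polynomial in [s]. *)
Lemma linear_form_supported xi a P :
  (forall l k, supported_transform K (fun z => P z * pairing l z ^+ k * cexp (pairing xi z))) ->
  forall l k, supported_transform K
    (fun z => pairing a z * P z * pairing l z ^+ k * cexp (pairing xi z)).
Proof.
move=> hP l k.
pose c (j : nat) (z : cV) := P z * (pairing l z ^+ (k.+1 - j) * pairing a z ^+ j *+ 'C(k.+1, j)) *
  cexp (pairing xi z).
have Wlin := @supported_transform_linear R n K.
have := coefficient_in_subspace (@supported_transform0 R n K) Wlin (d := k.+2) (c := c).
move=> /(_ _ 1%N isT) => Wc1.
have {Wc1} Wc : supported_transform K (c 1%N).
  apply: Wc1 => s; have := hP (l + s *: a) k.+1; congr (supported_transform K _).
  apply/funext => z; rewrite fct_sumE pairingDl pairingZl exprDn mulr_sumr mulr_suml.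
  apply: eq_bigr => j _; rewrite -[RHS]/(s ^+ j * _) /c exprMn.
  rewrite -(mulr_natr (_ * (_ * _))) -(mulr_natr (_ * pairing a z ^+ j)).
  move: (P z) (cexp _) (pairing l z ^+ _) (pairing a z ^+ j) (s ^+ j) ('C(k.+1, j)%:R).
  by move=> p e x y t b; ring.
have := Wlin k.+1%:R^-1 _ _ Wc (@supported_transform0 R n K).
congr (supported_transform K _); apply/funext => z.
rewrite fctE /= addr0 -[LHS]/(k.+1%:R^-1 * c 1%N z) /c subn1 /= expr1 bin1.
rewrite -(mulr_natr (_ * pairing a z)).
have : (k.+1%:R : R[i]) != 0 by rewrite pnatr_eq0.
by move: (k.+1%:R : R[i]) => b b0; field.
Qed.

(** The factors [z i] are brought in one by one, starting from a power of an
    arbitrary linear form, which is finally taken to be of exponent [0]. *)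
Lemma monomial_supported xi (m : 'I_n -> nat) : K xi ->
  supported_transform K (fun z => \prod_(i < n) z i ord0 ^+ m i * cexp (pairing xi z)).
Proof.
move=> Kxi.
have pow P i e :
  (forall l k, supported_transform K (fun z => P z * pairing l z ^+ k * cexp (pairing xi z))) ->
  forall l k, supported_transform K
    (fun z => z i ord0 ^+ e * P z * pairing l z ^+ k * cexp (pairing xi z)).
  move=> hP; elim: e => [|e ih] l k.
    by have := hP l k; congr (supported_transform K _); apply/funext => z; rewrite expr0 mul1r.
  have := linear_form_supported (delta_mx ord0 i) ih l k.
  congr (supported_transform K _); apply/funext => z.
  by rewrite pairing_delta exprS !mulrA.
suff all (s : seq 'I_n) l k : supported_transform K (fun z => \prod_(i <- s) z i ord0 ^+ m i *
    pairing l z ^+ k * cexp (pairing xi z)).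
  have := all (index_enum 'I_n) 0 0%N; congr (supported_transform K _).
  by apply/funext => z; rewrite expr0 mulr1.
elim: s l k => [|i s ih] l k.
  have := power_exponential_supported l k Kxi; congr (supported_transform K _).
  by apply/funext => z; rewrite big_nil mul1r.
have := pow _ i (m i) ih l k; congr (supported_transform K _).
by apply/funext => z; rewrite big_cons.
Qed.

Lemma meval_monomials N (p : mpoly n R[i]) (v : 'I_n -> R[i]) : (msize p <= N)%N ->
  meval v p = \sum_(m : bmultinom n N) mcoeff (bmnm m) p * \prod_(i < n) v i ^+ bmnm m i.
Proof.
move=> pN; rewrite {1}(mpolywE pN) raddf_sum /=; apply: eq_bigr => m _.
by rewrite mevalZ mevalX.
Qed.

Hypothesis finK : finite_set K.

Lemma ShatN_sum N (p : rV -> mpoly n R[i]) : (forall xi, K xi -> (msize (p xi) <= N.+1)%N) ->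
  (fun z : cV => \sum_(xi \in K) meval (fun i => z i ord0) (p xi) * cexp (pairing xi z)) =
  \sum_(xi <- fset_set K) \sum_(m : bmultinom n N.+1) mcoeff (bmnm m) (p xi) *:
     (fun z : cV => \prod_(i < n) z i ord0 ^+ bmnm m i * cexp (pairing xi z)).
Proof.
move=> pN; apply/funext => z; rewrite fsbig_finite // fct_sumE.
rewrite big_seq [RHS]big_seq; apply: eq_bigr => xi.
rewrite in_fset_set // => /set_mem/pN pxi.
rewrite (meval_monomials _ pxi) mulr_suml fct_sumE; apply: eq_bigr => m _.
by apply/esym; exact: mulrA.
Qed.

Lemma supported_transform_sum (I : Type) (s : seq I) (F : I -> cV -> R[i]) :
  (forall i, supported_transform K (F i)) -> supported_transform K (\sum_(i <- s) F i).
Proof.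
move=> hF; elim/big_ind : _ => //; first exact: supported_transform0.
by move=> f g hf hg; rewrite -[f]scale1r; exact: supported_transform_linear.
Qed.

Lemma ShatN_Shat N : K !=set0 -> ShatN N K `<=` Shat K.
Proof.
move=> K0 _ [p [pN ->]]; apply: (supported_transform_Shat (finite_compact finK) K0).
rewrite (ShatN_sum pN) big_seq; elim/big_ind : _.
- exact: supported_transform0.
- by move=> f g hf hg; rewrite -[f]scale1r; exact: supported_transform_linear.
move=> xi; rewrite in_fset_set // => /set_mem Kxi; apply: supported_transform_sum => m.
rewrite -[_ *: _]addr0; apply: supported_transform_linear; last exact: supported_transform0.
exact: monomial_supported.
Qed.

Lemma ShatN_linear_subspace N : linear_subspace (ShatN N K).
Proof.
split.
  exists (fun=> 0); split=> [xi _|]; first by rewrite msize0.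
  by apply/funext => z; rewrite fsbig1 // => xi _; rewrite meval0 mul0r.
move=> a f g [p [pN fE]] [q [qN gE]]; exists (fun xi => a *: p xi + q xi); split.
  move=> xi Kxi; apply: leq_trans (msizeD_le _ _) _.
  by rewrite geq_max (leq_trans (msizeZ_le _ _) (pN _ Kxi)) qN.
apply/funext => z; transitivity (a * f z + g z); first by [].
have E r : \sum_(xi \in K) meval (fun i => z i ord0) (r xi) * cexp (pairing xi z) =
    \sum_(xi <- fset_set K) meval (fun i => z i ord0) (r xi) * cexp (pairing xi z).
  exact: fsbig_finite.
have -> : f z = _ := etrans (congr1 (@^~ z) fE) (E p).
have -> : g z = _ := etrans (congr1 (@^~ z) gE) (E q).
rewrite E mulr_sumr -big_split /=.
by apply: eq_bigr => xi _; rewrite mevalD mevalZ; ring.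
Qed.

Lemma ShatN_quasi_monomial N xi (q : mpoly n R[i]) : K xi -> (msize q <= N.+1)%N ->
  ShatN N K (fun z => meval (fun i => z i ord0) q * cexp (pairing xi z)).
Proof.
move=> Kxi qN; exists (fun zeta => if zeta == xi then q else 0); split.
  by move=> zeta _; case: eqP => _; rewrite ?msize0.
apply/funext => z; rewrite fsbig_finite // (bigD1_seq xi) /=; last first.
- exact: finmap.fset_uniq.
- by rewrite in_fset_set //; exact: mem_set.
rewrite eqxx [X in _ + X]big1 ?addr0 // => zeta /negbTE ->.
by rewrite meval0 mul0r.
Qed.

Lemma exponential_ShatN N xi : K xi -> ShatN N K (fun z => cexp (pairing xi z)).
Proof.
move=> Kxi; have : (msize (1 : mpoly n R[i]) <= N.+1)%N by rewrite msize1.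
move=> /(ShatN_quasi_monomial Kxi); congr (ShatN N K _).
by apply/funext => z; rewrite meval1 mul1r.
Qed.

Lemma ShatN_finite_dimensional N : finite_dimensional (ShatN N K).
Proof.
pose xi_ := tnth (in_tuple (fset_set K)).
pose T := ('I_(size (fset_set K)) * bmultinom n N.+1)%type.
pose e (t : T) : cV -> R[i] :=
  fun z => \prod_(i < n) z i ord0 ^+ bmnm t.2 i * cexp (pairing (xi_ t.1) z).
have Te t : ShatN N K (e t).
  have Kxi : K (xi_ t.1).
    by have := mem_tnth t.1 (in_tuple (fset_set K)); rewrite in_fset_set // => /set_mem.
  have tN : (msize (mpolyX R[i] (bmnm t.2)) <= N.+1)%N by rewrite msizeX bmdeg.
  have := ShatN_quasi_monomial Kxi tN; congr (ShatN N K _).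
  by apply/funext => z; rewrite mevalX.
exists #|{: T}|, (fun i => e (enum_val i)); split=> [i|f [p [pN ->]]]; first exact: Te.
exists (fun i => let t := enum_val i in mcoeff (bmnm t.2) (p (xi_ t.1))).
rewrite (ShatN_sum pN) big_tnth pair_big /=.
rewrite (reindex (fun i : 'I_#|{: T}| => enum_val i)) //=.
by apply: onW_bij; exact: enum_val_bij.
Qed.

End QuasiPolynomials.
(** * Unit balls of finite-dimensional spaces *)

Section InnerProduct.
Variables (R : realType) (n : nat).
Notation cV := 'cV[R[i]]_n.
Variable ip : (cV -> R[i]) -> (cV -> R[i]) -> R[i].
Implicit Types (V : set (cV -> R[i])) (f g h b : cV -> R[i]).

Section Subspace.
Variable V : set (cV -> R[i]).
Hypotheses (subV : linear_subspace V) (ipV : hermitian_inner_product V ip).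

Lemma subspaceZ (a : R[i]) f : V f -> V (a *: f).
Proof. by case: subV => V0 Vlin Vf; rewrite -[_ *: _]addr0; exact: Vlin. Qed.

Lemma subspace_sum m (c : 'I_m -> R[i]) (b : 'I_m -> cV -> R[i]) :
  (forall i, V (b i)) -> V (\sum_(i < m) c i *: b i).
Proof.
case: subV => V0 Vlin Vb; elim/big_ind : _ => [//|f g Vf Vg|i _].
  by rewrite -[f]scale1r; exact: Vlin.
exact: subspaceZ.
Qed.

Lemma ip0l h : V h -> ip 0 h = 0.
Proof.
case: subV ipV => V0 _ [lin _ _] Vh; have := lin 1 0 0 h V0 V0 Vh.
by rewrite scale1r addr0 mul1r => /eqP; rewrite addrC -subr_eq subrr eq_sym => /eqP.
Qed.

Lemma ipZl (a : R[i]) f h : V f -> V h -> ip (a *: f) h = a * ip f h.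
Proof.
case: subV ipV => V0 _ [lin _ _] Vf Vh.
by rewrite -[a *: f]addr0 lin // ip0l // addr0.
Qed.

Lemma ipZr (a : R[i]) f h : V f -> V h -> ip h (a *: f) = Num.conj a * ip h f.
Proof.
move=> Vf Vh; case: (ipV) => _ sym _.
by rewrite [LHS](sym _ _ (subspaceZ a Vf) Vh) ipZl // rmorphM /= -sym.
Qed.

Lemma ip_suml m (c : 'I_m -> R[i]) (b : 'I_m -> cV -> R[i]) h :
  (forall i, V (b i)) -> V h -> ip (\sum_(i < m) c i *: b i) h = \sum_(i < m) c i * ip (b i) h.
Proof.
case: (ipV) => lin _ _; elim: m c b => [|m ih] c b Vb Vh; first by rewrite !big_ord0 ip0l.
rewrite !big_ord_recl lin ?ih //.
exact: subspace_sum.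
Qed.

Lemma ip_ge0 f : V f -> 0 <= ip f f.
Proof.
case: ipV => _ _ pos Vf; have [->|f0] := pselect (f = 0); last exact/ltW/pos.
by rewrite ip0l //; case: subV.
Qed.

Lemma ip_orthogonal_sum (c : R[i]) b g : V b -> V g -> ip g b = 0 ->
  ip (c *: b + g) (c *: b + g) = (`|c| ^+ 2) * ip b b + ip g g.
Proof.
case: (ipV) (subV) => lin sym _ [_ Vlin] Vb Vg gb.
have Vf := Vlin c _ _ Vb Vg; have Vcb := subspaceZ c Vb.
have bg : ip b g = 0 by rewrite (sym g b) // gb rmorph0.
rewrite [LHS]lin // (sym (c *: b + g) b) // (sym (c *: b + g) g) //.
rewrite !lin // gb bg mulr0 addr0 add0r -(sym g g) // rmorphM /= -(sym b b) //.
by rewrite normCK mulrA.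
Qed.

End Subspace.

(** Boundedness of the unit ball of a finite-dimensional space, in the form
    needed here: its elements are dominated pointwise by finitely many
    elements of the space. The vectors of a spanning family are split off one
    after the other, passing each time to an orthogonal complement. *)
Lemma unit_ball_dominated V m (b : 'I_m -> cV -> R[i]) :
  linear_subspace V -> hermitian_inner_product V ip -> (forall i, V (b i)) ->
  (forall f, V f -> exists c : 'I_m -> R[i], f = \sum_(i < m) c i *: b i) ->
  exists N (e : nat -> cV -> R[i]), (forall i, V (e i)) /\
    forall f, unit_ball V ip f -> forall z, cmod (f z) <= \sum_(i < N) cmod (e i z).
Proof.
elim: m V b => [|m ih] V b subV ipV Vb spanV.
  exists 0%N, (fun=> 0); split=> [_|f [Vf _] z]; first by case: subV.
  by have [c ->] := spanV f Vf; rewrite !big_ord0 cmod0.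
have [b0E|b0N] := pselect (b ord0 = 0).
  apply: (ih V (fun i => b (lift ord0 i))) => // f Vf; have [c ->] := spanV f Vf.
  by exists (fun i => c (lift ord0 i)); rewrite big_ord_recl b0E scaler0 add0r.
case: (subV) (ipV) => V0 Vlin [lin sym pos].
set b0 := b ord0 in b0N *; have Vb0 : V b0 := Vb ord0.
have p0 := pos _ Vb0 b0N; have p0' : ip b0 b0 != 0 by rewrite gt_eqF.
have [pE r0] := gt0_complexR p0; set r := complex.Re _ in pE r0.
pose W : set (cV -> R[i]) := [set f | V f /\ ip f b0 = 0].
pose lam f := ip f b0 / ip b0 b0.
have WV : W `<=` V by move=> f [].
have Wproj f : V f -> W (f - lam f *: b0).
  move=> Vf; have E : f - lam f *: b0 = (- lam f) *: b0 + f by rewrite scaleNr addrC.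
  split; first by rewrite E; exact: Vlin.
  by rewrite E lin // mulNr divfK // addNr.
have subW : linear_subspace W.
  split; first by split=> //; exact: (ip0l subV ipV).
  move=> a f g [Vf f0] [Vg g0]; split; first exact: Vlin.
  by rewrite lin // f0 g0 mulr0 addr0.
have ipW : hermitian_inner_product W ip.
  split.
  - by move=> a f g h /WV Vf /WV Vg /WV Vh; exact: lin.
  - by move=> f g /WV Vf /WV Vg; exact: sym.
  - by move=> f /WV; exact: pos.
pose b' i := b (lift ord0 i) - lam (b (lift ord0 i)) *: b0.
have Wb' i : W (b' i) by exact: Wproj.
have spanW f : W f -> exists c : 'I_m -> R[i], f = \sum_(i < m) c i *: b' i.
  move=> [Vf f0]; have [c fE] := spanV f Vf; exists (fun i => c (lift ord0 i)).
  have : ip f b0 = 0 := f0.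
  rewrite {1}fE (ip_suml subV ipV) // big_ord_recl -/b0 => E.
  have c0E : c ord0 = - \sum_(i < m) c (lift ord0 i) * lam (b (lift ord0 i)).
    apply: (mulIf p0'); rewrite mulNr mulr_suml; apply/eqP; rewrite -addr_eq0 -[X in _ == X]E.
    by apply/eqP; congr (_ + _); apply: eq_bigr => i _; rewrite -mulrA divfK.
  rewrite [LHS]fE big_ord_recl -/b0 c0E scaleNr scaler_suml addrC -sumrB.
  by apply: eq_bigr => i _; rewrite scalerBr scalerA.
have [N [e [We dom]]] := ih W b' subW ipW Wb' spanW.
pose s := Num.sqrt r.
have s0 : 0 < s by rewrite sqrtr_gt0.
exists N.+1, (fun i => if i is i'.+1 then e i' else (s^-1)%:C *: b0); split.
  case=> [|i]; last exact: WV (We i).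
  exact: (subspaceZ subV).
move=> f [Vf f1] z.
have [Vg g0] := Wproj f Vf; set g := f - lam f *: b0 in Vg g0.
have fE : f = lam f *: b0 + g by rewrite addrC subrK.
have pyth := ip_orthogonal_sum subV ipV (lam f) Vb0 Vg g0.
have g1 : ip g g <= 1.
  apply: le_trans f1; rewrite [in X in _ <= X]fE pyth lerDr.
  by rewrite mulr_ge0 ?exprn_ge0 // ltW.
have c1 : cmod (lam f) * s <= 1.
  rewrite -(@ler_pXn2r _ 2) ?nnegrE ?mulr_ge0 ?cmod_ge0 ?(ltW s0) // expr1n exprMn.
  rewrite sqr_sqrtr ?(ltW r0) // -lecR rmorphM rmorphXn /= -cmodE -pE.
  apply: le_trans f1; rewrite [in X in _ <= X]fE pyth lerDl.
  exact: (ip_ge0 subV ipV).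
rewrite big_ord_recl /= {1}fE; apply: le_trans (cmodD _ _) _; apply: lerD; last exact: dom.
rewrite -[(_ *: _) z]/(lam f * b0 z) -[(_ *: _) z]/((s^-1)%:C * b0 z) (cmodM (lam f)) (cmodM _%:C).
rewrite cmodR gtr0_norm ?invr_gt0 // ler_wpM2r ?cmod_ge0 //.
by rewrite -[s^-1]mul1r ler_pdivlMr.
Qed.

End InnerProduct.

(** * Growth of Borel-Fourier transforms *)

Section SupportFunction.
Variables (R : realType) (n : nat) (K : set 'rV[R[i]]_n).
Hypotheses (cK : compact K) (K0 : K !=set0).
Implicit Types (xi : 'rV[R[i]]_n) (z : 'cV[R[i]]_n).
Notation h := (support_function K).

Lemma support_function_attained z :
  exists2 xi, K xi & h z = complex.Re (pairing xi z) /\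
    forall zeta, K zeta -> complex.Re (pairing zeta z) <= h z.
Proof.
have [|xi Kxi ximax] := @compact_EVT_max _ R (fun xi => complex.Re (pairing xi z)) K K0 cK.
  apply: continuous_subspaceT => xi.
  apply: (@continuous_comp _ _ _ (fun xi => pairing xi z) (@complex.Re R)).
    exact: differentiable_continuous (differentiable_pairing z xi).
  exact: continuous_Re.
have {}Kxi := set_mem Kxi.
have {}ximax zeta : K zeta -> complex.Re (pairing zeta z) <= complex.Re (pairing xi z).
  by move=> Kz; apply: ximax; exact: mem_set.
have hE : h z = complex.Re (pairing xi z).
  apply/le_anti/andP; split.
  - by apply: ge_sup; [exists (complex.Re (pairing xi z)), xi|move=> _ [zeta Kz <-]; exact: ximax].
  - apply: ub_le_sup; last by exists xi.
    by exists (complex.Re (pairing xi z)) => _ [zeta Kz <-]; exact: ximax.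
by exists xi => //; split=> // zeta Kz; rewrite hE; exact: ximax.
Qed.

Lemma support_functionZ (t : R) z : 0 <= t -> h (t%:C *: z) <= t * h z.
Proof.
move=> t0; have [xi Kxi [-> _]] := support_function_attained (t%:C *: z).
have [_ _ [_ hz]] := support_function_attained z.
rewrite pairingZr; apply: le_trans (ler_wpM2l t0 (hz xi Kxi)).
by case: (pairing xi z) => u v /=; rewrite mul0r subr0.
Qed.

Definition l1_norm z : R := \sum_(j < n) cmod (z j ord0).

(** The functional is bounded by the supremum over the [e]-neighborhood of [K],
    where the real part of [xi z] exceeds [h z] by at most [e * l1_norm z]. *)
Lemma Shat_growth F (e : R) : Shat K F -> 0 < e ->
  exists2 C, 0 <= C & forall z, cmod (F z) <= C * expR (h z + e * l1_norm z).
Proof.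
move=> [mu [_ [_ smu] ->]] e0; pose U := \bigcup_(xi in K) ball xi e%:C.
have e0' : 0 < e%:C by rewrite ltcR.
have oU : open U by apply: bigcup_open => xi _; exact: ball_open.
have KU : K `<=` U by move=> xi Kxi; exists xi => //; exact: ballxx.
have [C C0 muC] := smu U oU KU; exists C => // z.
have := muC _ (entire_exponential z).
rewrite -lee_fin => /le_trans; apply; rewrite EFinM; apply: lee_wpmul2l; first by rewrite lee_fin.
apply: ub_ereal_sup => _ [x [xi Kxi [_ xxi]] <-].
rewrite lee_fin cmod_cexp ler_expR.
have [_ _ [_ hz]] := support_function_attained z.
have -> : x = xi + (x - xi) by rewrite addrC subrK.
rewrite pairingDl raddfD /=; apply: lerD; first exact: hz.
apply: le_trans (ler_norm _) _; apply: le_trans (cmod_Re _) _.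
rewrite pairingE; apply: le_trans (cmod_sum _ _ _) _; rewrite mulr_sumr; apply: ler_sum => j _.
rewrite cmodM ler_wpM2r ?cmod_ge0 // !mxE cmodB; apply: ltW.
by have := xxi ord0 j; rewrite -ball_normE /= cmodE ltcR.
Qed.

End SupportFunction.
(** * Regularity *)

Section Regularity.
Variables (R : realType) (n : nat) (K : set 'rV[R[i]]_n).
Notation cV := 'cV[R[i]]_n.
Notation h := (support_function K).
Variables (V : set (cV -> R[i])) (ip : (cV -> R[i]) -> (cV -> R[i]) -> R[i]).
Hypotheses (finK : finite_set K) (K0 : K !=set0).
Hypotheses (subV : linear_subspace V) (fdV : finite_dimensional V).
Hypotheses (VK : V `<=` Shat K) (KV : ShatN 0 K `<=` V).
Hypothesis ipV : hermitian_inner_product V ip.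
Local Notation B := (unit_ball V ip).

Lemma unit_ball_growth (e : R) : 0 < e ->
  exists2 C, 0 < C & forall f, B f -> forall z, cmod (f z) <= C * expR (h z + e * l1_norm z).
Proof.
move=> e0; have [m [b [Vb spanV]]] := fdV.
have [N [g [Vg dom]]] := unit_ball_dominated subV ipV Vb spanV.
have cK := finite_compact finK.
suff [C C0 hC] : exists2 C, 0 < C &
    forall z, \sum_(i < N) cmod (g i z) <= C * expR (h z + e * l1_norm z).
  by exists C => // f Bf z; apply: le_trans (dom f Bf z) (hC z).
elim: N {dom} => [|N [C C0 ih]].
  by exists 1 => // z; rewrite big_ord0 mul1r expR_ge0.
have [D D0 hD] := Shat_growth cK K0 (VK (Vg N)) e0.
exists (C + D) => [|z]; first exact: ltr_wpDr.
by rewrite big_ord_recr mulrDl lerD.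
Qed.

Let expo (xi : 'rV[R[i]]_n) : cV -> R[i] := fun z => cexp (pairing xi z).

Let Vexpo xi : K xi -> V (expo xi).
Proof. by move=> Kxi; apply: KV; exact: exponential_ShatN. Qed.

(** The lower estimate: one multiple works for all exponentials because [K] is
    finite. *)
Lemma unit_ball_exponentials :
  exists2 d, 0 < d & forall xi, K xi -> B (d%:C *: expo xi).
Proof.
have [s sK] := proj1 (finite_seqP K) finK.
pose q xi := complex.Re (ip (expo xi) (expo xi)).
have [M M1 hM] : exists2 M, 1 <= M & forall xi, xi \in s -> q xi <= M.
  elim: s {sK} => [|xi s [M M1 ih]]; first by exists 1.
  exists (M + `|q xi|) => [|zeta]; first exact: ler_wpDr.
  rewrite inE => /predU1P[->|/ih qM]; last exact: ler_wpDr.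
  by apply: ler_wpDl (ler_norm _); exact: le_trans M1.
have M0 : 0 < M := lt_le_trans ltr01 M1.
(* The squared norm of a vector scaled by 1 / M is q / M ^ 2, and q <= M <= M ^ 2. *)
exists M^-1 => [|xi Kxi]; first by rewrite invr_gt0.
have Ve := Vexpo Kxi; have VMe := subspaceZ subV (M^-1)%:C Ve; split=> //.
rewrite (ipZl subV ipV _ Ve VMe) (ipZr subV ipV _ Ve Ve).
have e0 : expo xi <> 0.
  move=> /(congr1 (@^~ 0)); rewrite /expo /pairing mulmx0 mxE cexp0.
  by apply/eqP; rewrite oner_eq0.
have [_ _ pos] := ipV; have /gt0_complexR[qE q0] := pos _ Ve e0.
have -> : Num.conj (M^-1)%:C = (M^-1)%:C :> R[i] by exact: conjc_real.
rewrite qE -!rmorphM /= -/(q xi) lecR.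
have qM : q xi <= M by apply: hM; move: Kxi; rewrite sK.
rewrite mulrC ler_pdivrMr // mul1r mulrC ler_pdivrMr //.
by apply: le_trans qM _; rewrite ler_peMl // ltW.
Qed.

Lemma log_growth_cvg : locally_uniform_cvg (log_growth B) h.
Proof.
have cK := finite_compact finK.
move=> z0; pose A := \sum_(j < n) (cmod (z0 j ord0) + 1).
have A0 : 0 <= A by apply: sumr_ge0 => j _; rewrite addr_ge0 ?cmod_ge0.
exists (ball z0 (1 : R[i])); first exact: nbhsx_ballx.
move=> e e0.
have [d d0 hd] := unit_ball_exponentials.
(* A bounds the l1 norm on the neighborhood, so that eps costs at most e / 2. *)
pose eps := e / (2 * (A + 1)).
have A1 : 0 < 2 * (A + 1) by rewrite mulr_gt0 // ltr_wpDl.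
have eps0 : 0 < eps by rewrite divr_gt0.
have [C C0 hC] := unit_ball_growth eps0.
(* After T the constants d and C cost less than e / 2 after division by t. *)
pose T := (`|ln d| + `|ln C|) / (e / 2).
have e2 : 0 < e / 2 by rewrite divr_gt0.
exists T; split; first exact: num_real.
move=> t Tt z [_ zz0].
have t0 : 0 < t by apply: le_lt_trans Tt; rewrite divr_ge0 // ?addr_ge0 // ltW.
have dC : `|ln d| + `|ln C| < e / 2 * t by rewrite mulrC -ltr_pdivrMr.
have l1z : l1_norm z <= A.
  apply: ler_sum => j _.
  have := zz0 j ord0; rewrite -ball_normE /= cmodE ltcR cmodB => /ltW zj.
  rewrite -[z j ord0](subrK (z0 j ord0)) addrC.
  by apply: le_trans (cmodD _ _) _; rewrite lerD2l.
have l1tz : l1_norm (t%:C *: z) = t * l1_norm z.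
  rewrite /l1_norm mulr_sumr; apply: eq_bigr => j _.
  by rewrite mxE cmodM cmodR gtr0_norm.
rewrite /log_growth; set S := ereal_sup _.
have Slow : ((d * expR (t * h z))%:E <= S)%E.
  have [xi Kxi [hE _]] := support_function_attained cK K0 z.
  apply: ereal_sup_ubound; exists (d%:C *: expo xi); first exact: hd.
  rewrite -[(_ *: expo xi) _]/(d%:C * expo xi (t%:C *: z)) cmodM cmodR gtr0_norm //.
  rewrite cmod_cexp pairingZr hE; congr ((d * expR _)%:E).
  by case: (pairing xi z) => u v /=; rewrite mul0r subr0.
have Sup : (S <= (C * expR (t * h z + eps * (t * A)))%:E)%E.
  apply: ub_ereal_sup => _ [f Bf <-]; rewrite lee_fin.
  apply: le_trans (hC f Bf _) _; rewrite ler_pM2l // ler_expR l1tz; apply: lerD.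
    by apply: (support_functionZ cK K0); exact: ltW.
  by rewrite ler_pM2l // ler_pM2l.
have [r rE] : exists r, S = r%:E.
  case: S Slow Sup => [r||] //; first by exists r.
rewrite rE !lee_fin in Slow Sup *.
have r0 : 0 < r by apply: lt_le_trans Slow; rewrite mulr_gt0 ?expR_gt0.
rewrite lne_EFin // -EFinM -EFinB abse_EFin lte_fin.
have low : ln d + t * h z <= ln r.
  by rewrite -[t * h z]expRK -lnM ?posrE ?expR_gt0 // ler_ln ?posrE // mulr_gt0 ?expR_gt0.
have up : ln r <= ln C + (t * h z + eps * (t * A)).
  rewrite -[X in _ + X]expRK -lnM ?posrE ?expR_gt0 // ler_ln ?posrE //.
  by rewrite mulr_gt0 ?expR_gt0.
have epsA : eps * (t * A) <= e / 2 * t.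
  rewrite mulrCA mulrC ler_pM2r //.
  have E : 2 * (eps * A) + 2 * eps = e.
    by rewrite -[RHS](divfK (lt0r_neq0 A1)) -/eps; ring.
  lra.
rewrite mulrC -(ltr_pM2r t0) -[X in _ * X < _](gtr0_norm t0) -normrM mulrBl divfK ?gt_eqF //.
rewrite [h z * t]mulrC ltr_norml.
have := ler_norm (- ln d); have := ler_norm (ln C); rewrite normrN => n1 n2.
have := normr_ge0 (ln d); have := normr_ge0 (ln C) => n3 n4.
have -> : e * t = e / 2 * t + e / 2 * t by field.
by apply/andP; split; lra.
Qed.

End Regularity.

Theorem theorem2 (R : realType) (n : nat) (K : set 'rV[R[i]]_n)
    (finK : finite_set K) (K0 : K !=set0) :
  (forall V : set ('cV[R[i]]_n -> R[i]),
     linear_subspace V -> finite_dimensional V ->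
     V `<=` Shat K -> ShatN 0 K `<=` V -> regular K V) /\
  (forall N : nat, regular K (ShatN N K)).
Proof.
have main V : linear_subspace V -> finite_dimensional V ->
    V `<=` Shat K -> ShatN 0 K `<=` V -> regular K V.
  by move=> subV fdV VK KV; split=> // ip ipV; exact: log_growth_cvg.
split=> // N; apply: main.
- exact: ShatN_linear_subspace.
- exact: ShatN_finite_dimensional.
- exact: ShatN_Shat.
- by move=> f [p [p0 ->]]; exists p; split=> // xi Kxi; apply: leq_trans (p0 xi Kxi) _.
Qed.
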